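(* Let $n$ and $k$ be integers with $k \geq 1$, and let $f(k) = \lceil 1.1 \ln(2.5k) \rceil$. If $n \geq f(k)$, then there are at least $k-1$ primes between $n$ and $kn$, i.e. in the interval $[n, kn]$.
   Context: $\ln$ denotes the natural logarithm and $\lceil \cdot \rceil$ the ceiling function. For integers $a \le b$, $[a,b]$ denotes the set of integers $a, a+1, \ldots, b$. *)

(* Defs.v *)
From mathcomp Require Import all_boot all_order all_algebra.
From mathcomp Require Import reals exp.

Set Implicit Arguments.
Unset Strict Implicit.
Unset Printing Implicit Defensive.

Import Order.TTheory GRing.Theory Num.Theory.
Local Open Scope ring_scope.

Definition f (R : realType) (k : int) : int :=
  Num.ceil ((11 / 10) * ln ((5 / 2) * k%:~R) : R).

(* [`|b|] only bounds the enumeration: a natural number p with p <= b in int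
   is at most [`|b|], and there is none when b < 0. *)
Definition primes_between (a b : int) : seq nat :=
  [seq p <- iota 0 `|b|.+1 | prime p & (a <= p%:Z <= b)].

(* Main.v *)
Require Import Defs.
From Stdlib Require Import ZArith.
From mathcomp Require Import all_boot all_order all_algebra.
From mathcomp Require Import all_classical reals topology normedtype derive realfun exp.
From mathcomp Require Import ssrZ zify ring lra.

(** Chebyshev's method. Write [x = k n]. The hypothesis says that [ln k] is at
    most [10/11 n - ln (5/2)], so [n] is at least about [1.1 ln x].

    Let [nu] be finitely many weights with [sum_d nu_d / d = 0]. By the
    factorisation of factorials, [sum_d nu_d ln ((x / d)!)] is the sum of
    [ln p * E (x / p^i)] over prime powers, with [E y = sum_d nu_d floor (y / d)],
    and Stirling's formula evaluates it as a constant times [x] up to [O(ln x)].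
    Chebyshev's weights 1, -2, -3, -5, 30 give [psi x <= 1.107 x + O(ln^2 x)].
    Weights supported in [1, 200], for which [E] exceeds 1 only beyond 80 and
    slowly, together with this upper bound give [psi x >= 0.97575 x - O(ln^2 x)].

    Suppose [x >= 270000]. If [n >= 3/2 ln x], the primes of [n, x] are counted by
    [psi x - psi n], which exceeds [(k - 1) ln x]. If [n < 3/2 ln x], it suffices
    that [pi x >= k + n], and a discrete partial summation turns the lower bound
    for [psi] into [pi x >= 0.97 x / ln x * (1 + 0.96 / ln x + ...)]; then
    [ln x = ln k + ln n <= 10/11 n + ln n - ln (5/2)] bounds [k = x / n].

    Suppose [x < 270000]. For [p < n <= q] with [p, q] consecutive primes, the
    worst case is [n = p + 1], and all [k] are checked on a sieved list of
    primes. For [n <= 12] the hypothesis bounds [k], by [10/11 <= ln (72/29)]. *)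

Set Implicit Arguments.
Unset Strict Implicit.
Unset Printing Implicit Defensive.

Import Order.TTheory GRing.Theory Num.Theory.
Local Open Scope ring_scope.
Delimit Scope Z_scope with BZ.

(** * Sums over prime powers *)

Section LogSums.
Variable R : realType.
Implicit Types (N x y d m p i : nat) (g h : nat -> R).

Lemma lnM_nat m d : (0 < m)%N -> (0 < d)%N ->
  ln (m * d)%:R = ln m%:R + ln d%:R :> R.
Proof. by move=> m0 d0; rewrite natrM lnM // posrE ltr0n. Qed.

Lemma ln_nat_ge0 m : 0 <= ln m%:R :> R.
Proof. by case: m => [|m]; [rewrite ln0 | rewrite ln_ge0 // ler1n]. Qed.

Lemma ln_nat_le m d : (0 < m)%N -> (m <= d)%N -> ln m%:R <= ln d%:R :> R.
Proof.
by move=> m0 md; rewrite ler_ln ?posrE ?ltr0n ?ler_nat // (leq_trans m0).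
Qed.

Lemma ln_le_sub1 (t : R) : 0 < t -> ln t <= t - 1.
Proof.
by move=> t0; have := @le_ln1Dx R (t - 1); rewrite addrCA subrr addr0; apply; lra.
Qed.

(* The truncation at [N] keeps the double sum finite; it is harmless as soon as
   [x < N] and [g 0 = 0]. *)
Definition ppsum N g x : R :=
  \sum_(0 <= p < N | prime p) \sum_(1 <= i < N) ln p%:R * g (x %/ p ^ i)%N.

Definition psi N x : R := ppsum N (fun y => (0 < y)%N%:R) x.

Lemma eq_ppsum N g h x : (forall y, (y <= x)%N -> g y = h y) ->
  ppsum N g x = ppsum N h x.
Proof.
move=> gh; apply: eq_bigr => p _; apply: eq_bigr => i _.
by rewrite gh // leq_div.
Qed.

Lemma ler_ppsum N g h x : (forall y, (y <= x)%N -> g y <= h y) ->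
  ppsum N g x <= ppsum N h x.
Proof.
move=> gh; apply: ler_sum => p _; apply: ler_sum => i _.
by rewrite ler_wpM2l ?ln_nat_ge0 // gh // leq_div.
Qed.

Lemma ppsumD N g h x :
  ppsum N (fun y => g y + h y) x = ppsum N g x + ppsum N h x.
Proof.
rewrite -big_split; apply: eq_bigr => p _; rewrite -big_split.
by apply: eq_bigr => i _; rewrite mulrDr.
Qed.

Lemma ppsumZ N (c : R) g x : ppsum N (fun y => c * g y) x = c * ppsum N g x.
Proof.
rewrite mulr_sumr; apply: eq_bigr => p _; rewrite mulr_sumr.
by apply: eq_bigr => i _; rewrite mulrCA.
Qed.

Lemma ppsum_sum N (I : Type) (s : seq I) (F : I -> nat -> R) x :
  ppsum N (fun y => \sum_(j <- s) F j y) x = \sum_(j <- s) ppsum N (F j) x.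
Proof.
elim: s => [|j s IH].
  rewrite big_nil /ppsum big1 // => p _; rewrite big1 // => i _.
  by rewrite big_nil mulr0.
rewrite big_cons -IH -ppsumD; apply: eq_ppsum => y _.
by rewrite big_cons.
Qed.

Lemma ppsum_divn N g x d :
  ppsum N g (x %/ d) = ppsum N (fun y => g (y %/ d)%N) x.
Proof.
by apply: eq_bigr => p _; apply: eq_bigr => i _; rewrite divnAC.
Qed.

(** Writing [psi] at [x / d] as a sum at [x] itself lets it be compared with [E] argument by
    argument. *)
Lemma psi_divn N x d : (0 < d)%N ->
  psi N (x %/ d) = ppsum N (fun y => (d <= y)%N%:R) x.
Proof.
by move=> d0; rewrite /psi ppsum_divn; apply: eq_ppsum => y _; rewrite divn_gt0.
Qed.

Lemma psi_ge0 N x : 0 <= psi N x.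
Proof.
by apply: sumr_ge0 => p _; apply: sumr_ge0 => i _; rewrite mulr_ge0 ?ln_nat_ge0.
Qed.

Lemma psi0 N : psi N 0 = 0.
Proof.
by rewrite /psi /ppsum big1 // => p _; rewrite big1 // => i _; rewrite div0n mulr0.
Qed.

Lemma ln_prodn (s : seq nat) (P : pred nat) (F : nat -> nat) :
  (forall i, P i -> (0 < F i)%N) ->
  ln (\prod_(i <- s | P i) F i)%N%:R = \sum_(i <- s | P i) ln (F i)%:R :> R.
Proof.
move=> F0; suff [] : (0 < \prod_(i <- s | P i) F i)%N /\
  ln (\prod_(i <- s | P i) F i)%N%:R = \sum_(i <- s | P i) ln (F i)%:R :> R by [].
elim/big_rec2: _ => [|i a b Pi [b0 <-]]; first by rewrite ln1.
by rewrite muln_gt0 F0 //= b0 lnM_nat // F0.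
Qed.

Lemma lnXn_nat m i : ln (m ^ i)%:R = i%:R * ln m%:R :> R.
Proof.
case: m => [|m]; last by rewrite natrX lnXn ?ltr0n // mulr_natl.
by case: i => [|i]; rewrite ?expn0 ?ln1 ?mul0r // exp0n // ln0 // mulr0.
Qed.

(** Legendre's formula: the exponent of [p] in the factorial is the sum of the [x %/ p ^ i]. *)
Lemma ln_factE N x : (x < N)%N -> ln x`!%:R = ppsum N (fun y => y%:R) x.
Proof.
move=> xN.
have x0 := fact_gt0 x.
have lg p : prime p -> (\sum_(1 <= i < N) x %/ p ^ i)%N = logn p x`!.
  move=> pp; rewrite logn_fact // (big_cat_nat (n := x.+1)) //=.
  rewrite [X in (_ + X)%N]big_nat_cond [X in (_ + X)%N]big1 ?addn0 // => i.
  rewrite andbT => /andP[xi _]; apply: divn_small.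
  exact: leq_trans xi (ltnW (ltn_expl _ (prime_gt1 pp))).
have -> : x`! = (\prod_(0 <= p < N | prime p) p ^ logn p x`!)%N.
  rewrite -{1}(partnT x0) /partn /=.
  have -> : (\prod_(0 <= p < x`!.+1 | p \in predT) p ^ logn p x`!)%N =
            (\prod_(0 <= p < x`!.+1 | prime p) p ^ logn p x`!)%N.
    rewrite big_mkcond [RHS]big_mkcond; apply: eq_bigr => p _ /=.
    by case: ifP => // /negbT pp; rewrite lognE (negbTE pp).
  (* A prime above [x] has exponent 0, so both products may be cut at [x]. *)
  have drop0 a b : (x < a)%N -> (\prod_(a <= p < b | prime p) p ^ logn p x`!)%N = 1%N.
    move=> xa; rewrite big_nat_cond big1 // => p /andP[/andP[ap _] pp].
    rewrite -lg // big_nat_cond big1 // => i /andP[/andP[i1 _] _].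
    apply: divn_small; apply: leq_trans xa (leq_trans ap _).
    by rewrite -{1}(expn1 p) leq_exp2l // prime_gt1.
  have xx : (x < x`!.+1)%N.
    by rewrite ltnS; case: (x) => // n; rewrite factS leq_pmulr // fact_gt0.
  rewrite (big_cat_nat (n := x.+1)) //= (drop0 x.+1) // muln1.
  by rewrite [RHS](big_cat_nat (n := x.+1)) //= (drop0 x.+1) // muln1.
rewrite ln_prodn => [|p pp]; last by rewrite expn_gt0 prime_gt0.
apply: eq_bigr => p pp; rewrite lnXn_nat -lg //.
by rewrite natr_sum mulr_suml; apply: eq_bigr => i _; rewrite mulrC.
Qed.

End LogSums.

(** * Bounds for the logarithm *)

Section LogBounds.
Import numFieldNormedType.Exports.
Local Open Scope classical_set_scope.
Local Open Scope ring_scope.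
Variable R : realType.

Lemma ge0_of_derive_ge0 (f df : R -> R) (b : R) : 0 <= b -> f 0 = 0 ->
  (forall x, 0 <= x <= b -> is_derive x 1 f (df x)) ->
  (forall x, 0 <= x <= b -> 0 <= df x) -> 0 <= f b.
Proof.
move=> b0 f0 fd df0.
have cf : {within `[0, b], continuous f}.
  apply: derivable_within_continuous => x /itvP xb.
  by have [] : is_derive x 1 f (df x) by apply: fd; rewrite !xb.
have [x /itvP xb|c cb] := MVT_segment (df := df) b0 _ cf.
  by apply: fd; rewrite !xb.
by rewrite f0 !subr0 => ->; rewrite mulr_ge0 // df0.
Qed.

(** Truncation of the series of [2 artanh z]: the difference has derivative [2 z^4 / (1 - z^2)]. *)
Lemma ln_atanh_ge (z : R) : 0 <= z -> z < 1 ->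
  2 * z + 2 / 3 * z ^+ 3 <= ln (1 + z) - ln (1 - z).
Proof.
move=> z0 z1; rewrite -subr_ge0.
pose f (t : R) := ln (1 + t) - ln (1 - t) - (2 * t + 2 / 3 * t ^+ 3).
pose df (t : R) := 2 / (1 - t ^+ 2) - (2 + 2 * t ^+ 2).
apply: (@ge0_of_derive_ge0 f df z z0).
- by rewrite /f; rewrite addr0 subr0 ln1; ring.
- move=> x /andP[x0 xz].
  have h1 : 0 < 1 + x by lra.
  have h2 : 0 < 1 - x by lra.
  have d1 := @is_derive1_ln R _ h1.
  have d2 := @is_derive1_ln R _ h2.
  rewrite /f; apply: is_derive_eq.
  rewrite /df /GRing.scale /=; field.
  by apply/and3P; split; apply: lt0r_neq0; nra.
- move=> x /andP[x0 xz]; rewrite /df.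
  have h : 0 < 1 - x ^+ 2 by nra.
  by rewrite subr_ge0 ler_pdivlMr //; nra.
Qed.

(** The terms after [2 z] are dominated by a geometric series of ratio [z^2]; the difference has
    derivative [4/3 z^4 / (1 - z^2)^2]. *)
Lemma ln_atanh_le (z : R) : 0 <= z -> z < 1 ->
  ln (1 + z) - ln (1 - z) <= 2 * z + 2 / 3 * z ^+ 3 * (1 - z ^+ 2)^-1.
Proof.
move=> z0 z1; rewrite -subr_ge0.
pose f (t : R) := 2 * t + 2 / 3 * t ^+ 3 * (1 - t ^+ 2)^-1 - (ln (1 + t) - ln (1 - t)).
pose df (t : R) := 4 / 3 * t ^+ 4 / (1 - t ^+ 2) ^+ 2.
apply: (@ge0_of_derive_ge0 f df z z0).
- by rewrite /f; rewrite addr0 subr0 ln1; ring.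
- move=> x /andP[x0 xz].
  have h1 : 0 < 1 + x by lra.
  have h2 : 0 < 1 - x by lra.
  have h3 : 1 - x ^+ 2 != 0 by apply: lt0r_neq0; nra.
  have d1 := @is_derive1_ln R _ h1.
  have d2 := @is_derive1_ln R _ h2.
  have d3 : is_derive x 1 (fun t : R => (1 - t ^+ 2)^-1) (- (1 - x ^+ 2) ^- 2 *: (- (2 * x))).
    apply: is_deriveV => //; apply: is_derive_eq.
    by rewrite /GRing.scale /=; ring.
  rewrite /f; apply: is_derive_eq.
  rewrite /df /GRing.scale /=; field.
  by rewrite h3 /=; apply/andP; split; apply: lt0r_neq0; nra.
- move=> x /andP[x0 xz]; rewrite /df.
  apply: mulr_ge0; last by rewrite invr_ge0 sqr_ge0.
  by apply: mulr_ge0; [lra | exact: exprn_ge0].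
Qed.

(** For [z = 1 / (2 m + 1)] the quotient [(1 + z) / (1 - z)] is [(m + 1) / m]. *)
Lemma ln_succE (m : nat) : (0 < m)%N ->
  ln m.+1%:R - ln m%:R = ln (1 + (2 * m%:R + 1)^-1) - ln (1 - (2 * m%:R + 1)^-1) :> R.
Proof.
move=> m0; have m0R : 0 < m%:R :> R by rewrite ltr0n.
have -> : 1 + (2 * m%:R + 1)^-1 = m.+1%:R * (2 / (2 * m%:R + 1)) :> R.
  by rewrite -natr1; field; apply: lt0r_neq0; lra.
have -> : 1 - (2 * m%:R + 1)^-1 = m%:R * (2 / (2 * m%:R + 1)) :> R.
  by field; apply: lt0r_neq0; lra.
have q0 : 0 < 2 / (2 * m%:R + 1) :> R by rewrite divr_gt0 //; lra.
rewrite !lnM ?posrE ?ltr0n //; lra.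
Qed.

Lemma ln_succ_ge (m : nat) : (0 < m)%N ->
  2 / (2 * m%:R + 1) + 2 / 3 / (2 * m%:R + 1) ^+ 3 <= ln m.+1%:R - ln m%:R :> R.
Proof.
move=> m0; have m0R : 1 <= m%:R :> R by rewrite ler1n.
rewrite ln_succE // -exprVn; apply: ln_atanh_ge.
  by rewrite invr_ge0; lra.
by rewrite invf_lt1; lra.
Qed.

Lemma ln_succ_le (m : nat) : (0 < m)%N ->
  ln m.+1%:R - ln m%:R <=
  2 / (2 * m%:R + 1) * (1 + 1 / (12 * m%:R * m.+1%:R)) :> R.
Proof.
move=> m0; have m0R : 1 <= m%:R :> R by rewrite ler1n.
rewrite ln_succE //; apply: le_trans (ln_atanh_le _ _) _.
- by rewrite invr_ge0; lra.
- by rewrite invf_lt1; lra.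
rewrite le_eqVlt; apply/orP; left; apply/eqP.
rewrite -natr1; field.
by apply/and4P; split; apply: lt0r_neq0; nra.
Qed.
End LogBounds.

(** * Stirling's formula *)

Section Factorial.
Variable R : realType.

(** The induction step amounts to [(m + 1/2) (ln (m + 1) - ln m) >= 1]. *)
Lemma ln_fact_le (m : nat) : (0 < m)%N ->
  ln m`!%:R <= (m%:R + 1 / 2) * ln m%:R - m%:R + 1 :> R.
Proof.
elim: m => // -[|m] IH _; first by rewrite factS fact0 muln1 ln1; lra.
rewrite factS lnM_nat ?fact_gt0 //.
have := IH isT; have := @ln_succ_ge R m.+1 isT.
have m0 : 1 <= m.+1%:R :> R by rewrite ler1n.
rewrite -(@natr1 _ m.+1); move: (ln (m.+1%:R + 1)) (ln m.+1%:R) m0 => a b.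
move: (m.+1%:R : R) => y y1 lo up.
have h : 1 <= (y + 1 / 2) * (a - b).
  have : (y + 1 / 2) * (2 / (2 * y + 1) + 2 / 3 / (2 * y + 1) ^+ 3) <= (y + 1 / 2) * (a - b).
    by rewrite ler_wpM2l //; lra.
  apply: le_trans.
  have -> : (y + 1 / 2) * (2 / (2 * y + 1) + 2 / 3 / (2 * y + 1) ^+ 3) = 1 + 1 / 3 / (2 * y + 1) ^+ 2.
    by field; apply: lt0r_neq0; lra.
  by rewrite lerDl divr_ge0 ?sqr_ge0 //; lra.
nra.
Qed.

Lemma ln_fact_ge (m : nat) : (0 < m)%N ->
  (m%:R + 1 / 2) * ln m%:R - m%:R + 11 / 12 <= ln m`!%:R :> R.
Proof.
move=> m0; have m0R : 1 <= m%:R :> R by rewrite ler1n.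
(* The extra term pays for the induction: one step loses at most [1 / (12 m) - 1 / (12 (m + 1))]. *)
suff : (m%:R + 1 / 2) * ln m%:R - m%:R + 11 / 12 + 1 / (12 * m%:R) <= ln m`!%:R :> R.
  by apply: le_trans; rewrite lerDl divr_ge0 //; lra.
elim: m m0 {m0R} => // -[|m] IH _; first by rewrite factS fact0 muln1 ln1; lra.
rewrite factS lnM_nat ?fact_gt0 //.
have := IH isT; have := @ln_succ_le R m.+1 isT.
have y1 : 1 <= m.+1%:R :> R by rewrite ler1n.
rewrite -(@natr1 _ m.+1); move: (ln (m.+1%:R + 1)) (ln m.+1%:R) => a b.
move: (m.+1%:R : R) y1 => y y1 up lo.
have h : (y + 1 / 2) * (a - b) <= 1 + 1 / (12 * y) - 1 / (12 * (y + 1)).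
  apply: le_trans (_ : (y + 1 / 2) * (2 / (2 * y + 1) * (1 + 1 / (12 * y * (y + 1)))) <= _).
    by rewrite ler_wpM2l //; lra.
  rewrite le_eqVlt; apply/orP; left; apply/eqP; field.
  by apply/and3P; split; apply: lt0r_neq0; lra.
nra.
Qed.

Lemma ln_div_nat (m d : nat) : (0 < m)%N -> (0 < d)%N ->
  ln (m%:R / d%:R) = ln m%:R - ln d%:R :> R.
Proof. by move=> m0 d0; rewrite ln_div // posrE ltr0n. Qed.

(** Stirling's formula at [m = floor t], [t = x / d], rewritten in terms of [t]. The constant [7/12]
    is the [1/12] of the lower Stirling bound plus [1/2], which comes from [ln t - ln m <= 1]. *)
Lemma fact_divn_bounds (x d : nat) : (0 < d <= x)%N ->
  (x%:R / d%:R * (ln x%:R - ln d%:R) - x%:R / d%:R + 1 - ((ln x%:R - ln d%:R) / 2 + 7 / 12)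
    <= ln (x %/ d)`!%:R :> R) &&
  (ln (x %/ d)`!%:R <= x%:R / d%:R * (ln x%:R - ln d%:R) - x%:R / d%:R + 1
    + (ln x%:R - ln d%:R) / 2 :> R).
Proof.
move=> /andP[d0 dx]; rewrite -ln_div_nat // ?(leq_trans d0) //.
set t : R := x%:R / d%:R.
have m0 : (0 < x %/ d)%N by rewrite divn_gt0.
have := @ln_fact_le _ m0; have := @ln_fact_ge _ m0.
have d0R : 0 < d%:R :> R by rewrite ltr0n.
have mt : (x %/ d)%:R <= t.
  by rewrite ler_pdivlMr // -natrM ler_nat leq_trunc_div.
have tm : t < (x %/ d)%:R + 1.
  by rewrite ltr_pdivrMr // natr1 -natrM ltr_nat -ltn_divLR.
have m1 : 1 <= (x %/ d)%:R :> R by rewrite ler1n.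
move: ((x %/ d)%:R : R) mt tm m1 => m mt tm m1 lo up.
have t1 : 1 <= t by lra.
have l1 := @ln_le_sub1 R (t / m) ltac:(by rewrite divr_gt0; lra).
have l2 := @ln_le_sub1 R (m / t) ltac:(by rewrite divr_gt0; lra).
rewrite ln_div ?posrE in l1 l2; try lra.
rewrite ln_div ?posrE in l2; try lra.
(* [a1] and [a2] are the tangent inequalities of the convex function [u ln u - u] at [t] and at
   [m]. *)
have a1 : m * (ln t - ln m) <= t - m.
  have -> : t - m = m * (t / m - 1) by field; apply: lt0r_neq0; lra.
  by rewrite ler_wpM2l //; lra.
have a2 : t * (ln m - ln t) <= m - t.
  have -> : m - t = t * (m / t - 1) by field; apply: lt0r_neq0; lra.
  by rewrite ler_wpM2l //; lra.
have lm0 : 0 <= ln m by rewrite ln_ge0.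
have lmt : ln m <= ln t by rewrite ler_ln ?posrE //; lra.
have lmt1 : ln t - ln m <= 1.
  apply: le_trans l1 _; rewrite lerBlDr ler_pdivrMr; lra.
by apply/andP; split; nra.
Qed.

Definition zero_sum (s : seq (nat * R)) := \sum_(u <- s) u.2 / u.1%:R = 0.
(** The coefficient of [x] in the weighted sum of log-factorials: under [zero_sum] the terms in
    [x ln x] and the remaining multiples of [x] cancel. *)
Definition log_mean (s : seq (nat * R)) : R := - \sum_(u <- s) u.2 / u.1%:R * ln u.1%:R.
Definition mass (s : seq (nat * R)) : R := \sum_(u <- s) `|u.2|.

Lemma weighted_fact_bounds (s : seq (nat * R)) (x : nat) : zero_sum s ->
  (forall u, u \in s -> (0 < u.1 <= x)%N) ->
  `|\sum_(u <- s) u.2 * ln (x %/ u.1)`!%:R - log_mean s * x%:R - \sum_(u <- s) u.2|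
   <= mass s * (ln x%:R / 2 + 7 / 12).
Proof.
move=> zs sx.
pose t (u : nat * R) : R := x%:R / u.1%:R.
pose l (u : nat * R) : R := ln x%:R - ln u.1%:R.
have e : log_mean s * x%:R + \sum_(u <- s) u.2 =
    \sum_(u <- s) u.2 * (t u * l u - t u + 1).
  have -> : \sum_(u <- s) u.2 * (t u * l u - t u + 1) =
      \sum_(u <- s) (u.2 / u.1%:R * (x%:R * (ln x%:R - 1)) + (- x%:R * (u.2 / u.1%:R * ln u.1%:R) + u.2)).
    rewrite !big_seq; apply: eq_bigr => u /sx /andP[u0 ux].
    by rewrite /t /l; field; rewrite pnatr_eq0 -lt0n.
  rewrite big_split /= -mulr_suml zs mul0r add0r big_split /= -mulr_sumr.
  by rewrite /log_mean; ring.
rewrite -addrA -opprD e -sumrB; apply: le_trans (ler_norm_sum _ _ _) _.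
rewrite /mass mulr_suml !big_seq; apply: ler_sum => u us.
have /andP[u0 ux] := sx _ us.
rewrite -mulrBr normrM ler_wpM2l //.
have := fact_divn_bounds (sx _ us); rewrite -/(t u) -/(l u) => /andP[lo up].
have lt : l u <= ln x%:R by rewrite /l gerBl ln_nat_ge0.
have lt0 : 0 <= l u by rewrite /l subr_ge0 ln_nat_le.
by rewrite ler_norml; apply/andP; split; lra.
Qed.
End Factorial.

(** * A table of logarithms *)

Definition ln_scale : Z := 1000000000.

(** With [q = 2 m + 1], so that [4 m (m + 1) = q^2 - 1], these are the bounds of [ln_succ_ge] and
    [ln_succ_le] as single fractions, rounded down and up. *)
Definition ln_step_lo (m : Z) : Z :=
  let q := (2 * m + 1)%BZ in (ln_scale * (6 * q * q + 2) / (3 * q * q * q))%BZ.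
Definition ln_step_hi (m : Z) : Z :=
  let q := (2 * m + 1)%BZ in
  (ln_scale * (6 * q * q - 4) / (3 * q * (q * q - 1)) + 1)%BZ.

Definition sum4 (g : Z -> Z) (m : Z) : Z := (g m + (g (m + 1) + (g (m + 2) + g (m + 3))))%BZ.

(* The entry for [d] bounds [ln_scale * ln d]; it is advanced through
   [ln (d + 1) - ln d = ln (4 d + 4) - ln (4 d)], that is by four of the more
   accurate steps at [m = 4 d]. *)
Fixpoint ln_table (n : nat) (m lo hi : Z) : seq (Z * Z) :=
  if n is n'.+1 then
    (lo, hi) :: ln_table n' (m + 4) (lo + sum4 ln_step_lo m) (hi + sum4 ln_step_hi m)
  else [::].

Section LogTable.
Variable R : realType.

Definition ZR (z : Z) : R := (int_of_Z z)%:~R.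

Lemma ZRD a b : ZR (a + b)%BZ = ZR a + ZR b.
Proof. by rewrite /ZR -rmorphD /=; congr (_%:~R); lia. Qed.
Lemma ZRM a b : ZR (a * b)%BZ = ZR a * ZR b.
Proof. by rewrite /ZR -rmorphM /=; congr (_%:~R); lia. Qed.
Lemma ZRN a : ZR (- a)%BZ = - ZR a.
Proof. by rewrite /ZR -rmorphN /=; congr (_%:~R); lia. Qed.
Lemma ZRB a b : ZR (a - b)%BZ = ZR a - ZR b.
Proof. by rewrite -ZRN -ZRD. Qed.
Lemma ZR_nat n : ZR (Z.of_nat n) = n%:R.
Proof. by rewrite /ZR -[n%:R]/(n%:~R); congr (_%:~R); lia. Qed.
Lemma ZR_le a b : (a <= b)%BZ -> ZR a <= ZR b.
Proof. by move=> ab; rewrite ler_int; lia. Qed.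
Lemma ZR_lt a b : (a < b)%BZ -> ZR a < ZR b.
Proof. by move=> ab; rewrite ltr_int; lia. Qed.

Lemma ZR_div_le a b : (0 < b)%BZ -> ZR (a / b)%BZ <= ZR a / ZR b.
Proof.
move=> b0; have b0' : 0 < ZR b by exact: (ZR_lt b0).
rewrite ler_pdivlMr // -ZRM; apply: ZR_le.
by have := Z.mul_div_le a b b0; lia.
Qed.

Lemma ZR_div_ge a b : (0 < b)%BZ -> ZR a / ZR b <= ZR (a / b + 1)%BZ.
Proof.
move=> b0; have b0' : 0 < ZR b by exact: (ZR_lt b0).
rewrite ler_pdivrMr // -ZRM; apply: ZR_le.
by have := Z.mul_succ_div_gt a b b0; lia.
Qed.

Lemma ZR_ge0 a : (0 <= a)%BZ -> 0 <= ZR a.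
Proof. exact: ZR_le. Qed.

Lemma ln_scale_ge0 : 0 <= ZR ln_scale.
Proof. by apply: ZR_ge0; rewrite /ln_scale; lia. Qed.

Lemma ln_stepP (m : nat) : (0 < m)%N ->
  ZR (ln_step_lo (Z.of_nat m)) <= ZR ln_scale * (ln m.+1%:R - ln m%:R)
    <= ZR (ln_step_hi (Z.of_nat m)).
Proof.
move=> m0; have m1 : 1 <= m%:R :> R by rewrite ler1n.
rewrite /ln_step_lo /ln_step_hi; have := ln_scale_ge0; move: ln_scale => c c0.
have e1 : ZR 1 = 1 by [].
have e2 : ZR 2 = 2 by [].
have e3 : ZR 3 = 3 by [].
have e4 : ZR 4 = 4 by [].
have e6 : ZR 6 = 6 by [].
apply/andP; split.
- apply: le_trans (ZR_div_le _ _) _; first by nia.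
  apply: le_trans (ler_wpM2l c0 (ln_succ_ge R m0)).
  rewrite !(ZRM, ZRD) ZR_nat e1 e2 e3 e6 le_eqVlt; apply/orP; left; apply/eqP.
  by field; apply: lt0r_neq0; lra.
- apply: le_trans (ZR_div_ge _ _); last by nia.
  apply: le_trans (ler_wpM2l c0 (ln_succ_le R m0)) _.
  rewrite !(ZRM, ZRD, ZRB) ZR_nat e1 e2 e3 e4 e6 -natr1 le_eqVlt; apply/orP; left; apply/eqP.
  by field; apply/and4P; split; apply: lt0r_neq0; nra.
Qed.

Lemma sum4P (m : nat) : (0 < m)%N ->
  ZR (sum4 ln_step_lo (Z.of_nat m)) <= ZR ln_scale * (ln (m + 4)%:R - ln m%:R)
    <= ZR (sum4 ln_step_hi (Z.of_nat m)).
Proof.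
move=> m0; rewrite /sum4; move: (ZR ln_scale) (@ln_stepP) => c st.
have -> : (Z.of_nat m + 1 = Z.of_nat m.+1)%BZ by lia.
have -> : (Z.of_nat m + 2 = Z.of_nat m.+2)%BZ by lia.
have -> : (Z.of_nat m + 3 = Z.of_nat m.+3)%BZ by lia.
have -> : (m + 4 = m.+4)%N by lia.
have /andP[] := st m m0; have /andP[] := st m.+1 isT.
have /andP[] := st m.+2 isT; have /andP[] := st m.+3 isT.
rewrite !ZRD => *; apply/andP; split; lra.
Qed.

Lemma ln_tableP n (d : nat) (lo hi : Z) : (0 < d)%N ->
  ZR lo <= ZR ln_scale * ln d%:R <= ZR hi ->
  forall i, (i < n)%N ->
  let u := nth (0, 0)%BZ (ln_table n (Z.of_nat (4 * d)) lo hi) i in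
  ZR u.1 <= ZR ln_scale * ln (d + i)%:R <= ZR u.2.
Proof.
move: (ZR ln_scale) (@sum4P) => c s4; elim: n d lo hi => // n IH d lo hi d0 dlh [|i] i_n; first by rewrite addn0.
rewrite /= addnS -addSn.
have -> : (Z.of_nat (4 * d) + 4 = Z.of_nat (4 * d.+1))%BZ by lia.
apply: IH => //; move: dlh => /andP[l h].
have /andP[] := s4 (4 * d)%N ltac:(lia).
have -> : (4 * d + 4 = 4 * d.+1)%N by lia.
rewrite !lnM_nat // !ZRD => *; apply/andP; split; lra.
Qed.

Definition ln_tab : seq (Z * Z) := ln_table 200 4 0 0.

Lemma ln_tabP (d : nat) : (0 < d <= 200)%N ->
  let u := nth (0, 0)%BZ ln_tab d.-1 in
  ZR u.1 <= ZR ln_scale * ln d%:R <= ZR u.2.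
Proof.
move=> /andP[d0 d200].
have := @ln_tableP 200 1 0 0 isT _ d.-1.
by rewrite add1n prednK // ln1 mulr0 lexx; apply.
Qed.

Lemma ln_tab_ge (a b d : nat) : (0 < d <= 200)%N -> (0 < b)%N ->
  Z.leb (Z.of_nat a * ln_scale) (Z.of_nat b * (nth (0, 0)%BZ ln_tab d.-1).1) ->
  a%:R / b%:R <= ln d%:R :> R.
Proof.
move=> /ln_tabP /= /andP[lo _] b0 /Z.leb_le /ZR_le; rewrite !ZRM !ZR_nat.
have c0 : 0 < ZR ln_scale by exact: (ZR_lt (a := 0)).
have b0R : 0 < b%:R :> R by rewrite ltr0n.
move: lo c0; move: (ZR ln_scale) => c lo c0 h.
rewrite ler_pdivrMr // -(ler_pM2r c0); apply: le_trans h _.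
by have := ler_wpM2l (ltW b0R) lo; lra.
Qed.

Lemma ln_tab_le (a b d : nat) : (0 < d <= 200)%N -> (0 < b)%N ->
  Z.leb (Z.of_nat b * (nth (0, 0)%BZ ln_tab d.-1).2) (Z.of_nat a * ln_scale) ->
  ln d%:R <= a%:R / b%:R :> R.
Proof.
move=> /ln_tabP /= /andP[_ hi] b0 /Z.leb_le /ZR_le; rewrite !ZRM !ZR_nat.
have c0 : 0 < ZR ln_scale by exact: (ZR_lt (a := 0)).
have b0R : 0 < b%:R :> R by rewrite ltr0n.
move: hi c0; move: (ZR ln_scale) => c hi c0 h.
rewrite ler_pdivlMr // -(ler_pM2r c0); apply: le_trans h.
by have := ler_wpM2l (ltW b0R) hi; lra.
Qed.
End LogTable.

(** * Upper bound for psi *)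

Section PsiUpper.
Variable R : realType.

Lemma ln2_bounds : 693 / 1000 <= ln 2 :> R /\ ln 2 <= 694 / 1000 :> R.
Proof. split; [apply: (@ln_tab_ge R 693 1000 2 isT isT) | apply: (@ln_tab_le R 694 1000 2 isT isT)]; by vm_compute. Qed.
Lemma ln3_bounds : 1098 / 1000 <= ln 3 :> R /\ ln 3 <= 1099 / 1000 :> R.
Proof. split; [apply: (@ln_tab_ge R 1098 1000 3 isT isT) | apply: (@ln_tab_le R 1099 1000 3 isT isT)]; by vm_compute. Qed.
Lemma ln5_bounds : 1609 / 1000 <= ln 5 :> R /\ ln 5 <= 1610 / 1000 :> R.
Proof. split; [apply: (@ln_tab_ge R 1609 1000 5 isT isT) | apply: (@ln_tab_le R 1610 1000 5 isT isT)]; by vm_compute. Qed.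

(** As [1 - 1/2 - 1/3 - 1/5 + 1/30 = 0], Chebyshev's function has period 30, and one period shows it
    nonnegative, and at least 1 on [[1, 5]]. *)
Lemma chebyshev_weights_le (y : nat) :
  ((0 < y) + (y %/ 2 + y %/ 3 + y %/ 5) <= (6 <= y) + (y + y %/ 30))%N.
Proof.
have dv d c : (0 < d)%N -> (c * d)%N = 30%N ->
    (y %/ d = y %/ 30 * c + y %% 30 %/ d)%N.
  by move=> d0 cd; rewrite [in LHS](divn_eq y 30) -[in LHS]cd mulnA divnMDl // cd.
rewrite (dv 2%N 15%N) // (dv 3%N 10%N) // (dv 5%N 6%N) //.
have := ltn_pmod y (isT : (0 < 30)%N); have := divn_eq y 30.
move: (y %/ 30)%N (y %% 30)%N => q r yE r30.
have /allP/(_ r) : all (fun r => ((0 < r) + (r %/ 2 + r %/ 3 + r %/ 5) <= (6 <= r) + r)%N) (iota 0 30) by [].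
rewrite mem_iota => /(_ r30).
move: (r %/ 2)%N (r %/ 3)%N (r %/ 5)%N => a b c h.
move: h; case: (leqP 6 r) => r6; case: (leqP 6 y) => y6; case: (ltnP 0 r) => r0;
  case: (ltnP 0 y) => y0 /=; lia.
Qed.


(** Covers also [d > x], where the factorial is 1; this occurs for [d = 30] and [6 <= x < 30]. *)
Lemma ln_fact_div_le (x d : nat) : (0 < x)%N -> (0 < d)%N ->
  ln (x %/ d)`!%:R <= x%:R / d%:R * (ln x%:R - ln d%:R) - x%:R / d%:R + 1 + ln x%:R / 2 :> R.
Proof.
move=> x0 d0; have l0 : 0 <= ln x%:R :> R by rewrite ln_nat_ge0.
have ld0 : 0 <= ln d%:R :> R by rewrite ln_nat_ge0.
have x0R : 0 < x%:R :> R by rewrite ltr0n.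
have d0R : 0 < d%:R :> R by rewrite ltr0n.
have [dx|xd] := leqP d x.
  have dx' : (0 < d <= x)%N by rewrite d0.
  have /andP[_] := @fact_divn_bounds R x d dx'.
  move=> h; apply: le_trans h _.
  rewrite lerD2l; move: ld0; clear.
  by move: (ln d%:R) (ln x%:R) => b a b0; lra.
rewrite divn_small // fact0 ln1.
have := @ln_le_sub1 R (d%:R / x%:R) (divr_gt0 d0R x0R).
rewrite ln_div_nat // => h.
have : x%:R / d%:R * (ln d%:R - ln x%:R) <= x%:R / d%:R * (d%:R / x%:R - 1) :> R.
  by rewrite ler_wpM2l // divr_ge0 // ltW.
have -> : x%:R / d%:R * (d%:R / x%:R - 1) = 1 - x%:R / d%:R :> R.
  by field; rewrite !lt0r_neq0.
by move: (ln x%:R) (ln d%:R) (x%:R / d%:R) l0 => {h}; clear => a b t *; lra.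
Qed.

(** [461/500] exceeds Chebyshev's constant [ln 2 / 2 + ln 3 / 3 + ln 5 / 5 - ln 30 / 30 =
    0.9212...]. *)
Lemma psi_sub_div6_arith (X l l2 l3 l5 l30 p q T1 T2 T3 T5 T30 : R) :
  p + (T2 + T3 + T5) <= q + (T1 + T30) ->
  T1 <= (X + 1 / 2) * l - X + 1 ->
  X / 2 * (l - l2) - X / 2 + 1 - ((l - l2) / 2 + 7 / 12) <= T2 ->
  X / 3 * (l - l3) - X / 3 + 1 - ((l - l3) / 2 + 7 / 12) <= T3 ->
  X / 5 * (l - l5) - X / 5 + 1 - ((l - l5) / 2 + 7 / 12) <= T5 ->
  T30 <= X / 30 * (l - l30) - X / 30 + 1 + l / 2 ->
  l30 = l2 + l3 + l5 ->
  X * (l2 / 2 + l3 / 3 + l5 / 5 - (l2 + l3 + l5) / 30) <= X * (461 / 500) ->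
  693 / 1000 <= l2 -> 1098 / 1000 <= l3 -> 1609 / 1000 <= l5 ->
  p - q <= 461 / 500 * X + 5 / 2 * l.
Proof. by move=> h1 h2 h3 h4 h5 h6 h7; subst l30 => *; lra. Qed.

Lemma psi_sub_div6 (N x : nat) : (6 <= x)%N -> (x < N)%N ->
  psi R N x - psi R N (x %/ 6) <= 461 / 500 * x%:R + 5 / 2 * ln x%:R.
Proof.
move=> x6 xN.
have T d : ln (x %/ d)`!%:R = ppsum N (fun y => (y %/ d)%:R) x :> R.
  by rewrite (@ln_factE R N) ?ppsum_divn // (leq_ltn_trans (leq_div _ _)).
have [a2 b2] := ln2_bounds; have [a3 b3] := ln3_bounds; have [a5 b5] := ln5_bounds.
have le1 : psi R N x + (ln (x %/ 2)`!%:R + ln (x %/ 3)`!%:R + ln (x %/ 5)`!%:R) <=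
    psi R N (x %/ 6) + (ln x`!%:R + ln (x %/ 30)`!%:R).
  rewrite !T (@ln_factE R N) // psi_divn // /psi -!ppsumD.
  by apply: ler_ppsum => y _; rewrite /= -!natrD ler_nat chebyshev_weights_le.
have x0 : (0 < x)%N by apply: leq_trans x6.
have X0 : 6 <= x%:R :> R by rewrite (ler_nat R 6 x).
have t1 := @ln_fact_le R x x0.
have := @fact_divn_bounds R x 2 (leq_trans (isT : (2 <= 6)%N) x6); move=> /andP[t2 _].
have := @fact_divn_bounds R x 3 (leq_trans (isT : (3 <= 6)%N) x6); move=> /andP[t3 _].
have := @fact_divn_bounds R x 5 (leq_trans (isT : (5 <= 6)%N) x6); move=> /andP[t5 _].
have l30 : ln 30 = ln 2 + ln 3 + ln 5 :> R.
  by rewrite -(@lnM_nat R 2 3) // -(@lnM_nat R (2 * 3) 5).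
have t30 := ln_fact_div_le x0 (isT : (0 < 30)%N).
have A : x%:R * (ln 2 / 2 + ln 3 / 3 + ln 5 / 5 - (ln 2 + ln 3 + ln 5) / 30) <= 
   x%:R * (461 / 500) :> R.
  apply: ler_wpM2l; first exact: ler0n.
  by clear -a2 a3 a5 b2 b3 b5; lra.
exact: (psi_sub_div6_arith le1 t1 t2 t3 t5 t30 l30 A a2 a3 a5).
Qed.

Lemma psi_small (N x : nat) : (0 < x < 6)%N -> (x < N)%N ->
  psi R N x <= 1107 / 1000 * x%:R.
Proof.
move=> /andP[x0 x6] xN.
have [a2 b2] := ln2_bounds; have [a3 b3] := ln3_bounds; have [a5 b5] := ln5_bounds.
have : psi R N x <= ln x`!%:R.
  rewrite (@ln_factE R N) //; apply: ler_ppsum => y _.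
  by rewrite ler_nat; case: y.
move=> /le_trans; apply; apply: le_trans (ln_fact_le R x0) _.
have l4 : ln 4 = 2 * ln 2 :> R.
  by rewrite -[4](_ : 2 * 2 = _ :> R) ?lnM ?posrE //; ring.
case: x x0 x6 xN => [|[|[|[|[|[|x]]]]]] //= _ _ _; rewrite ?ln1 ?l4; lra.
Qed.

(** Iterating [psi_sub_div6] sums a geometric series, with [0.922 * 6/5 < 1.107], and about
    [ln x / ln 6] logarithmic errors, with [2.5 / (2 ln 6) < 0.7]. *)
Lemma psi_le (N x : nat) : (0 < x)%N -> (x < N)%N ->
  psi R N x <= 1107 / 1000 * x%:R + (7 / 10 * ln x%:R ^+ 2 + 127 / 100 * ln x%:R).
Proof.
elim/ltn_ind: x => x IH x0 xN.
have l0 : 0 <= ln x%:R :> R by rewrite ln_nat_ge0.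
have [x6|x6] := ltnP x 6.
  have := @psi_small N x ltac:(lia) xN; nra.
have := psi_sub_div6 x6 xN.
have y0 : (0 < x %/ 6)%N by rewrite divn_gt0.
have yx : (x %/ 6 < x)%N by rewrite ltn_Pdiv.
have := IH _ yx y0 (ltn_trans yx xN).
have [a2 b2] := ln2_bounds; have [a3 b3] := ln3_bounds.
have y0R : 0 < (x %/ 6)%:R :> R by rewrite ltr0n.
have yR : (x %/ 6)%:R <= x%:R / 6 :> R.
  by rewrite ler_pdivlMr // -natrM ler_nat leq_trunc_div.
have ly : ln (x %/ 6)%:R <= ln x%:R - (ln 2 + ln 3) :> R.
  rewrite -lnM ?posrE // -ln_div ?posrE ?ltr0n //; last by lra.
  by rewrite ler_ln ?posrE ?divr_gt0 ?ltr0n //; lra.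
have ly0 : 0 <= ln (x %/ 6)%:R :> R by rewrite ln_nat_ge0.
move: (ln (x %/ 6)%:R) (ln x%:R) ly ly0 l0 => m l ml m0 l0 h1 h2.
have m2 : m ^+ 2 <= (l - (ln 2 + ln 3)) ^+ 2 by rewrite lerXn2r ?nnegrE //; lra.
(* From [ln 6 >= 1.791] and [(ln 6)^2 <= 1.793^2 < 3.22]. *)
have : (l - (ln 2 + ln 3)) ^+ 2 <= l ^+ 2 - 3582 / 1000 * l + 322 / 100 by nra.
lra.
Qed.
End PsiUpper.

(** * The weights *)

(* Four times the weights [nu_d] for [2 <= d <= 200], found by linear programming
   followed by a local search. The weight of 1, close to 1, is the one that makes
   [sum_d nu_d / d] vanish. *)
Definition zweights : seq (nat * Z) := Eval vm_compute in
  [seq (Z.to_nat u.1, u.2) | u <- ([::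
   (2, -4); (3, -4); (5, -4); (6, 4); (7, -4); (10, 4); (11, -4); (13, -4);
   (14, 4); (15, 4); (17, -4); (19, -4); (21, 4); (22, 4); (23, -4); (26, 4);
   (29, -4); (30, -4); (31, -4); (33, 4); (34, 4); (35, 4); (37, -4); (38, 4);
   (39, 1); (41, -1); (42, -4); (43, -4); (46, 4); (47, -4); (51, 4); (53, -4);
   (55, 3); (57, 3); (58, 4); (59, -2); (61, -4); (62, 4); (65, 1); (66, -5);
   (69, 4); (70, -4); (71, -4); (73, -4); (74, 4); (77, 3); (78, -1); (79, -3);
   (80, 1); (82, 1); (83, -4); (85, 4); (86, 4); (91, 3); (93, 1); (94, 1);
   (95, -3); (97, -2); (102, -3); (105, -1); (109, -4); (110, -3); (111, 3);
   (113, -3); (114, -2); (115, 4); (118, 3); (119, 6); (122, 4); (123, -1);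
   (127, -2); (131, -1); (133, 4); (137, -3); (138, -5); (139, -3); (141, 2);
   (142, 3); (143, 4); (145, 2); (146, 2); (151, -1); (154, -6); (155, 1);
   (159, 4); (161, 2); (163, 1); (164, -1); (165, -1); (166, 2); (167, 3);
   (168, -1); (170, -3); (171, -1); (172, -1); (173, -1); (177, -3); (178, 1);
   (181, -4); (182, -4); (183, 5); (186, 1); (187, 2); (190, 1); (192, 1);
   (195, 1); (197, -1); (198, -1); (199, -2)]%BZ : seq (Z * Z))].

(* Four times the jumps of a step function [g] with [E y <= 1 + g y]. The last
   one pays for the trivial bound on [E] beyond [nrange]. *)
Definition zsteps : seq (nat * Z) := Eval vm_compute in
  [seq (Z.to_nat u.1, u.2) | u <- ([::
   (80, 1); (114, 1); (167, 5); (374, 1); (467, 1); (503, 1); (888, 1); (1193,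
   3); (1201, 1); (1499, 1); (3469, 2); (5869, 2); (12919, 2); (20000, 141)]%BZ : seq (Z * Z))].

(* Lists hold the increments of a function at 1, 2, ...; adding [v * floor (y / d)]
   to the function adds [v] to every [d]-th entry, which takes no arithmetic on [y]. *)
Fixpoint add_every (d c : nat) (v : Z) (l : seq Z) : seq Z :=
  if l is h :: t then
    if c is c'.+1 then h :: add_every d c' v t else (h + v)%BZ :: add_every d d v t
  else [::].

Fixpoint add_at (c : nat) (v : Z) (l : seq Z) : seq Z :=
  if l is h :: t then
    if c is c'.+1 then h :: add_at c' v t else (h + v)%BZ :: t
  else [::].

Fixpoint prefix_sums_le (b acc : Z) (l : seq Z) : bool :=
  if l is h :: t then
    let a := (acc + h)%BZ in Z.leb a b && prefix_sums_le b a t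
  else true.

Definition psum (l : seq Z) (y : nat) : Z := foldr Z.add 0%BZ (take y l).

Lemma psum0 l : psum l 0 = 0%BZ. Proof. by rewrite /psum take0. Qed.

(** [c] entries precede the first one changed and the period is [d + 1], so the first [y] entries
    contain [floor ((y + d - c) / (d + 1))] changed ones. *)
Lemma psum_add_every d v l c y : (y <= size l)%N -> (c <= d)%N ->
  psum (add_every d c v l) y = (psum l y + v * Z.of_nat ((y + (d - c)) %/ d.+1))%BZ.
Proof.
elim: l c y => [|h t IH] c [|y] //=.
- by move=> _ _; rewrite psum0 add0n divn_small ?ltnS ?leq_subr //; lia.
- by move=> _ cd; rewrite !psum0 add0n divn_small ?ltnS ?leq_subr //; lia.
rewrite ltnS => yt; case: c => [|c] cd; rewrite /psum /= -!/(psum _ _).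
  rewrite (IH d y yt (leqnn d)) subnn addn0 subn0 addSnnS divnDr ?dvdnn // divnn /=.
  by lia.
by rewrite (IH c y yt (ltnW cd)) addSn -addnS -subSn // subSS; lia.
Qed.

Lemma size_add_every d c v l : size (add_every d c v l) = size l.
Proof. by elim: l c => [|h t IH] [|c] //=; rewrite IH. Qed.

Lemma size_add_at c v l : size (add_at c v l) = size l.
Proof. by elim: l c => [|h t IH] [|c] //=; rewrite IH. Qed.

Lemma psum_add_at v l c y : (y <= size l)%N ->
  psum (add_at c v l) y = (psum l y + v * Z.of_nat (c < y)%N)%BZ.
Proof.
elim: l c y => [|h t IH] c [|y] //=; try by move=> _; rewrite ?psum0; lia.
rewrite ltnS => yt; case: c => [|c]; rewrite /psum /= -!/(psum _ _); first lia.
by rewrite IH // ltnS; lia.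
Qed.

Lemma prefix_sums_leP b acc l y : prefix_sums_le b acc l -> (0 < y <= size l)%N ->
  (acc + psum l y <= b)%BZ.
Proof.
elim: l acc y => [|h t IH] acc [|y] //= /andP[/Z.leb_le hb tl] /=.
rewrite ltnS /psum /= -!/(psum _ _) => yt.
case: y yt => [|y] yt; first by rewrite psum0; lia.
by have := IH _ y.+1 tl yt; lia.
Qed.

(** The increments of [4 (E - g)], with the weight of 1 replaced by its upper bound 1. *)
Definition excess_list (n : nat) : seq Z :=
  foldr (fun u l => add_at u.1.-1 (- u.2) l)
    (foldr (fun u l => add_every u.1.-1 u.1.-1 u.2 l) (nseq n 0%BZ) ((1%N, 4%BZ) :: zweights))
    zsteps.

Definition zfloor_sum (s : seq (nat * Z)) (y : nat) : Z :=
  foldr (fun u a => (u.2 * Z.of_nat (y %/ u.1) + a)%BZ) 0%BZ s.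
Definition zstep_sum (s : seq (nat * Z)) (y : nat) : Z :=
  foldr (fun u a => (u.2 * Z.of_nat (u.1 <= y)%N + a)%BZ) 0%BZ s.

Lemma psum_nseq0 n y : psum (nseq n 0%BZ) y = 0%BZ.
Proof.
by rewrite /psum; elim: n y => [|n IH] [|y] //=.
Qed.

Lemma psum_every_list s l y : all (fun u => 0 < u.1)%N s -> (y <= size l)%N ->
  psum (foldr (fun u l => add_every u.1.-1 u.1.-1 u.2 l) l s) y =
  (psum l y + zfloor_sum s y)%BZ /\
  size (foldr (fun u l => add_every u.1.-1 u.1.-1 u.2 l) l s) = size l.
Proof.
move=> + yl; elim: s => [|[d v] s IH] /=; first by split=> //; lia.
move=> /andP[d0 /IH[e1 e2]]; rewrite size_add_every e2; split=> //.
by rewrite psum_add_every ?e2 // e1 subnn addn0 prednK //; lia.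
Qed.

Lemma psum_at_list s l y : all (fun u => 0 < u.1)%N s -> (y <= size l)%N ->
  psum (foldr (fun u l => add_at u.1.-1 (- u.2) l) l s) y =
  (psum l y - zstep_sum s y)%BZ /\
  size (foldr (fun u l => add_at u.1.-1 (- u.2)%BZ l) l s) = size l.
Proof.
move=> + yl; elim: s => [|[d v] s IH] /=; first by split=> //; lia.
move=> /andP[d0 /IH[e1 e2]]; rewrite size_add_at e2; split=> //.
by rewrite psum_add_at ?e2 // e1 prednK //; lia.
Qed.

(* Such numbers are kept as products because numerals are unary. *)
Definition nrange : nat := 200 * 100.

Lemma excess_check : prefix_sums_le 4 0 (excess_list nrange).
Proof. by vm_compute. Qed.

Lemma floor_sum_le_small (y : nat) : (0 < y <= nrange)%N ->
  (zfloor_sum ((1%N, 4%BZ) :: zweights) y <= 4 + zstep_sum zsteps y)%BZ.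
Proof.
move=> /andP[y0 yn].
have sz : size (nseq nrange 0%BZ) = nrange by rewrite size_nseq.
have ok1 : all (fun u => 0 < u.1)%N ((1%N, 4%BZ) :: zweights) by vm_compute.
have ok2 : all (fun u => 0 < u.1)%N zsteps by vm_compute.
have yn1 : (y <= size (nseq nrange 0%BZ))%N by rewrite sz.
have := @prefix_sums_leP _ _ _ y excess_check; rewrite /excess_list.
have [] := psum_every_list ok1 yn1; set l := foldr _ _ _ => e1 z1.
have yn2 : (y <= size l)%N by rewrite z1.
have [] := psum_at_list ok2 yn2; set l' := foldr _ _ _ => e2 z2.
by rewrite z2 z1 sz y0 yn e2 e1 psum_nseq0 => /(_ isT); lia.
Qed.

(** * Lower bound for psi *)

Definition zsum (T : Type) (g : T -> Z) (s : seq T) : Z :=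
  foldr (fun u a => (g u + a)%BZ) 0%BZ s.

Definition big_scale : Z := 1000000000000.

(** A lower bound for [- 4 nu_d ln d / d] in units of [1 / ln_scale]; the sign of the weight selects
    the safe end of the table entry. *)
Definition zlog_term (u : nat * Z) : Z :=
  let t := nth (0, 0)%BZ ln_tab u.1.-1 in
  (- (u.2 * (if Z.ltb u.2 0 then t.1 else t.2)) / Z.of_nat u.1)%BZ.

(** In the same units, minus the cost of a jump at [d], where [psi (x / d)] is worth
    [1.107 x / d]. *)
Definition zstep_term (u : nat * Z) : Z :=
  (- (1107 * 1000000 * u.2) / Z.of_nat u.1)%BZ.

Section PsiLower.
Variable R : realType.

(** The weighted sum of log-factorials is the prime-power sum of [E]. The pointwise majorant of [E]
    has the prime-power sum on the right, each jump at [d] giving a [psi (x / d)]. *)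
Lemma psi_ge_weighted (N x : nat) (s W : seq (nat * R)) : (x < N)%N ->
  zero_sum s -> (forall u, u \in s -> (0 < u.1 <= x)%N) ->
  (forall u, u \in W -> (0 < u.1)%N) ->
  (forall y, (y <= x)%N -> \sum_(u <- s) u.2 * (y %/ u.1)%:R <=
     (0 < y)%N%:R + \sum_(u <- W) u.2 * (u.1 <= y)%N%:R) ->
  log_mean s * x%:R + \sum_(u <- s) u.2 - mass s * (ln x%:R / 2 + 7 / 12) <=
  psi R N x + \sum_(u <- W) u.2 * psi R N (x %/ u.1).
Proof.
move=> xN zs sx W0 le.
have -> : \sum_(u <- W) u.2 * psi R N (x %/ u.1) =
    ppsum N (fun y => \sum_(u <- W) u.2 * (u.1 <= y)%N%:R) x.
  rewrite ppsum_sum !big_seq; apply: eq_bigr => u /W0 u0.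
  by rewrite ppsumZ psi_divn.
rewrite /psi -ppsumD; apply: le_trans (ler_ppsum N le).
rewrite ppsum_sum.
have -> : \sum_(u <- s) ppsum N (fun y => u.2 * (y %/ u.1)%:R) x =
    \sum_(u <- s) u.2 * ln (x %/ u.1)`!%:R.
  apply: eq_bigr => u _; rewrite ppsumZ (@ln_factE R N) ?ppsum_divn //.
  by rewrite (leq_ltn_trans (leq_div _ _)).
have := weighted_fact_bounds zs sx; rewrite ler_norml => /andP[lo _].
have arith (a b c e : R) : - e <= a - b - c -> b + c - e <= a by move=> ?; lra.
exact: arith lo.
Qed.

Lemma ZR_zsum_le (T : eqType) (F : T -> R) g s :
  {in s, forall u, ZR R (g u) <= F u} -> ZR R (zsum g s) <= \sum_(u <- s) F u.
Proof.
elim: s => [|u s IH] gF; first by rewrite big_nil.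
rewrite big_cons /= ZRD lerD //; first by apply: gF; rewrite mem_head.
by apply: IH => v vs; apply: gF; rewrite inE vs orbT.
Qed.

Lemma ZR_zsum_ge (T : eqType) (F : T -> R) g s :
  {in s, forall u, F u <= ZR R (g u)} -> \sum_(u <- s) F u <= ZR R (zsum g s).
Proof.
elim: s => [|u s IH] gF; first by rewrite big_nil.
rewrite big_cons /= ZRD lerD //; first by apply: gF; rewrite mem_head.
by apply: IH => v vs; apply: gF; rewrite inE vs orbT.
Qed.

Lemma ZR_zsum (T : eqType) (g : T -> Z) s : ZR R (zsum g s) = \sum_(u <- s) ZR R (g u).
Proof. by apply/le_anti/andP; split; [apply: ZR_zsum_le | apply: ZR_zsum_ge]. Qed.

Definition tail_weights : seq (nat * R) := [seq (u.1, ZR R u.2 / 4) | u <- zweights].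
Definition head_weight : R := - \sum_(u <- tail_weights) u.2 / u.1%:R.
Definition weights : seq (nat * R) := (1%N, head_weight) :: tail_weights.
Definition steps : seq (nat * R) := [seq (u.1, ZR R u.2 / 4) | u <- zsteps].

Lemma weights_zero_sum : zero_sum weights.
Proof. by rewrite /zero_sum big_cons /= divr1 /head_weight addNr. Qed.

Lemma zweights_range u : u \in zweights -> (0 < u.1 <= 200)%N.
Proof. by move: u; apply/allP; vm_compute. Qed.

Lemma zsteps_range u : u \in zsteps -> (80 <= u.1 <= nrange)%N && Z.leb 0 u.2.
Proof. by move: u; apply/allP; vm_compute. Qed.

Definition zinv_term (u : nat * Z) : Z := (- (big_scale * u.2) / Z.of_nat u.1)%BZ.

(** In order: the weight of 1 lies in [[0, 1]] (two checks); the other absolute weights total at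
    most [81] and the other weights at least [-3]; the negative weights total at most 1 plus all
    jumps; the main constant is at least [3.903 / 4]. *)
Lemma zweight_checks :
  [&& Z.leb 0 (zsum zinv_term zweights),
      Z.leb (zsum (fun u => zinv_term u + 1)%BZ zweights) (4 * big_scale),
      Z.leb (zsum (fun u => Z.abs u.2) zweights) 324,
      Z.leb (-12) (zsum snd zweights),
      Z.leb (zsum (fun u => Z.max 0 (- u.2)) zweights) (4 + zsum snd zsteps) &
      Z.leb (3903 * 1000000) (zsum zlog_term zweights + zsum zstep_term zsteps)].
Proof. by vm_compute. Qed.

Lemma head_weight_bounds : 0 <= head_weight <= 1.
Proof.
have /and4P[/Z.leb_le c1 /Z.leb_le c2 _ _] := zweight_checks.
have sc0 : 0 < ZR R big_scale by apply: (@ZR_lt R 0).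
have e : 4 * ZR R big_scale * head_weight =
    \sum_(u <- zweights) (ZR R (- (big_scale * u.2))%BZ / ZR R (Z.of_nat u.1)).
  rewrite /head_weight big_map mulrN mulr_sumr -sumrN; apply: eq_bigr => u _.
  by rewrite ZRN ZRM ZR_nat /=; move: (u.1%:R^-1 : R) (ZR R u.2) (ZR R big_scale) => a b c; field.
have pos u : u \in zweights -> (0 < Z.of_nat u.1)%BZ.
  by move=> /zweights_range /andP[u0 _]; lia.
have lo : 0 <= 4 * ZR R big_scale * head_weight.
  rewrite e; apply: (le_trans (ZR_le R c1)); apply: ZR_zsum_le.
  by move=> u /pos u0; apply: (ZR_div_le R).
have hi : 4 * ZR R big_scale * head_weight <= 4 * ZR R big_scale.
  have -> : 4 * ZR R big_scale = ZR R (4 * big_scale)%BZ by rewrite ZRM.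
  rewrite [X in X * _]ZRM e; apply: (le_trans _ (ZR_le R c2)); apply: ZR_zsum_ge.
  by move=> u /pos u0; apply: (ZR_div_ge R).
move: lo hi sc0; move: (ZR R big_scale) => c lo hi c0.
have c4 : 0 < 4 * c by rewrite mulr_gt0.
rewrite -(pmulr_rge0 _ c4) lo /=.
by rewrite -(ler_pM2l c4) mulr1.
Qed.

Lemma mass_weights : mass weights <= 82.
Proof.
have /and4P[_ _ /Z.leb_le c3 _] := zweight_checks.
rewrite /mass big_cons /=; have /andP[h0 h1] := head_weight_bounds.
rewrite ger0_norm // big_map /=.
have -> : \sum_(u <- zweights) `|ZR R u.2 / 4| = ZR R (zsum (fun u => Z.abs u.2) zweights) / 4.
  rewrite ZR_zsum mulr_suml; apply: eq_bigr => u _; rewrite normrM.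
  rewrite [`|4^-1|]ger0_norm ?invr_ge0 //; congr (_ * _).
  by rewrite /ZR -intr_norm; congr (_%:~R); lia.
have := ZR_le R c3; have -> : ZR R 324 = 324 by [].
by move: (ZR R _) head_weight h1 => a b *; lra.
Qed.

Lemma sum_weights_ge : - 3 <= \sum_(u <- weights) u.2.
Proof.
have /and5P[_ _ _ /Z.leb_le c4 _] := zweight_checks.
rewrite big_cons /=; have /andP[h0 h1] := head_weight_bounds.
rewrite big_map /= -mulr_suml -ZR_zsum.
have := ZR_le R c4; have -> : ZR R (-12) = -12 by [].
by move: (ZR R _) head_weight h0 => a b *; lra.
Qed.

Lemma weights_range u : u \in weights -> (0 < u.1 <= 200)%N.
Proof.
rewrite inE => /predU1P[-> //|/mapP[v /zweights_range vr ->]].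
exact: vr.
Qed.

Lemma steps_range u : u \in steps -> (80 <= u.1 <= nrange)%N /\ 0 <= u.2.
Proof.
move=> /mapP[v /zsteps_range /andP[vr /Z.leb_le v0] ->]; split=> //=.
by rewrite divr_ge0 // ZR_ge0.
Qed.

Lemma ZR_zfloor_sum s y : ZR R (zfloor_sum s y) =
  \sum_(u <- s) ZR R u.2 * (y %/ u.1)%:R.
Proof.
elim: s => [|u s IH]; first by rewrite big_nil.
by rewrite big_cons /= ZRD ZRM ZR_nat IH.
Qed.

Lemma ZR_zstep_sum s y : ZR R (zstep_sum s y) =
  \sum_(u <- s) ZR R u.2 * (u.1 <= y)%N%:R.
Proof.
elim: s => [|u s IH]; first by rewrite big_nil.
by rewrite big_cons /= ZRD ZRM ZR_nat IH.
Qed.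

Lemma floor_sum_weights_le (y : nat) :
  \sum_(u <- weights) u.2 * (y %/ u.1)%:R <=
     (0 < y)%N%:R + \sum_(u <- steps) u.2 * (u.1 <= y)%N%:R.
Proof.
have /andP[h0 h1] := head_weight_bounds.
have [->|y0] : y = 0%N \/ (0 < y)%N by case: (y); [left | right].
  rewrite ltnn mulr0n add0r big1 => [|u _]; last by rewrite div0n mulr0.
  rewrite big_seq; apply: sumr_ge0 => u /steps_range[_ u0].
  by rewrite mulr_ge0.
have steps4 : \sum_(u <- steps) u.2 * (u.1 <= y)%N%:R = ZR R (zstep_sum zsteps y) / 4.
  by rewrite big_map ZR_zstep_sum mulr_suml; apply: eq_bigr => u _; rewrite mulrAC.
have [yn|ny] := leqP y nrange.
  have yr : (0 < y <= nrange)%N by rewrite y0.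
  have := ZR_le R (floor_sum_le_small yr).
  rewrite ZRD ZR_zfloor_sum big_cons [X in (y %/ X)%N]/= divn1 [(1%N, 4%BZ).2]/=.
  have -> : ZR R 4 = 4 by [].
  have -> : \sum_(u <- weights) u.2 * (y %/ u.1)%:R =
      head_weight * y%:R + (\sum_(j <- zweights) ZR R j.2 * (y %/ j.1)%:R) / 4.
    rewrite /weights [LHS]big_cons /= divn1 big_map mulr_suml; congr (_ + _).
    by apply: eq_bigr => u _; rewrite mulrAC.
  rewrite steps4 y0.
  (* The list was checked with weight 1 at [d = 1]; the true weight is no larger. *)
  have hy : head_weight * y%:R <= y%:R by rewrite ler_piMl.
  move: hy; move: (\sum_(j <- zweights) _) (ZR R (zstep_sum _ _)) => a b.
  by move: (head_weight * y%:R) => c; move: (y%:R : R) => d *; rewrite mulr1n; lra.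
(* Beyond [nrange], [E] is minus the weighted sum of the fractional parts of [y / d]. They lie in
   [[0, 1)], so [E] is at most the total of the negative weights, and [d = 1] drops out. *)
have -> : \sum_(u <- weights) u.2 * (y %/ u.1)%:R =
    \sum_(u <- weights) u.2 * ((y %/ u.1)%:R - y%:R / u.1%:R).
  rewrite [RHS](eq_bigr (fun u => u.2 * (y %/ u.1)%:R - y%:R * (u.2 / u.1%:R))).
    by rewrite sumrB -mulr_sumr weights_zero_sum mulr0 subr0.
  by move=> u _; ring.
rewrite big_cons /= divn1 divr1 subrr mulr0 add0r big_map /=.
have /and5P[_ _ _ _ /andP[/Z.leb_le c5 _]] := zweight_checks.
apply: (@le_trans _ _ (ZR R (zsum (fun u => Z.max 0 (- u.2)) zweights) / 4)).
  rewrite ZR_zsum mulr_suml !big_seq; apply: ler_sum => u /zweights_range /andP[u0 _].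
  have u0R : 0 < u.1%:R :> R by rewrite ltr0n.
  have f1 : (y %/ u.1)%:R <= y%:R / u.1%:R :> R.
    by rewrite ler_pdivlMr // -natrM ler_nat leq_trunc_div.
  have f2 : y%:R / u.1%:R <= (y %/ u.1)%:R + 1 :> R.
    by rewrite ltW // ltr_pdivrMr // natr1 -natrM ltr_nat -ltn_divLR.
  move: f1 f2; move: ((y %/ u.1)%:R : R) (y%:R / u.1%:R) => a b f1 f2.
  have z0 : ZR R 0 = 0 by [].
  have [un|up] := Z.lt_ge_cases u.2 0.
    have -> : Z.max 0 (- u.2) = (- u.2)%BZ by lia.
    by have := ZR_lt R un; rewrite ZRN z0; move: (ZR R u.2) => v v0; nra.
  have -> : Z.max 0 (- u.2) = 0%BZ by lia.
  have := ZR_ge0 R up; rewrite z0.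
  by move: (ZR R u.2) => v v0; nra.
rewrite y0 steps4.
have -> : zstep_sum zsteps y = zsum snd zsteps.
  rewrite /zstep_sum /zsum; have : {in zsteps, forall u, (u.1 <= y)%N}.
    by move=> u /zsteps_range /andP[/andP[_ ur] _]; apply: leq_trans ur (ltnW ny).
  elim: zsteps => //= u s IH le; rewrite le ?mem_head // IH; last first.
    by move=> v vs; apply: le; rewrite inE vs orbT.
  by case: u {le} => u1 u2 /=; lia.
have := ZR_le R c5; rewrite [X in _ <= X -> _]ZRD; have -> : ZR R 4 = 4 by [].
move: (ZR R (zsum _ zweights)) (ZR R (zsum snd zsteps)) => a b h.
by rewrite mulr1n; lra.
Qed.

Lemma zlog_termP u : u \in zweights ->
  ZR R (zlog_term u) <= - (ZR R u.2 / u.1%:R * ln u.1%:R) * ZR R ln_scale.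
Proof.
move=> /zweights_range ur; have uz : (0 < Z.of_nat u.1)%BZ by lia.
have /= /andP[lo hi] := @ln_tabP R _ ur.
have /andP[u0 _] := ur; have u0R : 0 < u.1%:R :> R by rewrite ltr0n.
rewrite /zlog_term; set t := nth _ _ _ in lo hi *.
apply: le_trans (ZR_div_le R _ uz) _.
rewrite ZRN ZRM ZR_nat ler_pdivrMr //.
have -> : - (ZR R u.2 / u.1%:R * ln u.1%:R) * ZR R ln_scale * u.1%:R =
    - (ZR R u.2 * (ZR R ln_scale * ln u.1%:R)).
  by move: (ZR R ln_scale) => c; field; rewrite lt0r_neq0.
rewrite lerN2; case: Z.ltb_spec => un.
  have := ZR_lt R un; have -> : ZR R 0 = 0 by [].
  by move=> v0; rewrite ler_wnM2l // ltW.
by rewrite ler_wpM2l // ZR_ge0.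
Qed.

Lemma zstep_termP u : u \in zsteps ->
  ZR R (zstep_term u) <= - (1107 * (ZR R u.2 / u.1%:R)) * ZR R 1000000.
Proof.
move=> /zsteps_range /andP[/andP[u80 _] _].
have u0 : (0 < u.1)%N by apply: leq_trans u80.
have uz : (0 < Z.of_nat u.1)%BZ by lia.
have u0R : 0 < u.1%:R :> R by rewrite ltr0n.
apply: le_trans (ZR_div_le R _ uz) _.
rewrite ZRN !ZRM ZR_nat ler_pdivrMr //.
have -> : ZR R 1107 = 1107 by [].
rewrite le_eqVlt; apply/orP; left; apply/eqP.
by move: (ZR R 1000000) => c; field; rewrite lt0r_neq0.
Qed.

(** [3903/4000 = 0.97575] is what remains of the Stirling constant once every jump is paid for
    through [psi (x / d) <= 1.107 x / d + ...]. *)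
Lemma log_mean_ge :
  3903 / 4000 + 1107 / 1000 * (\sum_(u <- steps) u.2 / u.1%:R) <= log_mean weights.
Proof.
have /and5P[_ _ _ _ /andP[_ /Z.leb_le c6]] := zweight_checks.
have := ZR_le R c6; rewrite [X in _ <= X -> _]ZRD => {c6}c6.
have h0 : 0 < ZR R 1000000 by apply: (@ZR_lt R 0).
have l1 := ZR_zsum_le zlog_termP; have l2 := ZR_zsum_le zstep_termP.
have := le_trans c6 (lerD l1 l2).
rewrite -!mulr_suml !sumrN -mulr_sumr [ZR R (3903 * _)%BZ]ZRM.
have -> : ZR R ln_scale = 1000 * ZR R 1000000.
  have -> : ln_scale = (1000 * 1000000)%BZ by [].
  have e3 : ZR R 1000 = 1000 by [].
  by rewrite ZRM e3.
have -> : ZR R 3903 = 3903 by [].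
have -> : log_mean weights = - (\sum_(u <- zweights) ZR R u.2 / u.1%:R * ln u.1%:R) / 4.
  rewrite /log_mean /weights [X in - X]big_cons /= ln1 mulr0 add0r big_map mulNr mulr_suml.
  by congr (- _); apply: eq_bigr => u _ /=; ring.
have -> : \sum_(u <- steps) u.2 / u.1%:R = (\sum_(u <- zsteps) ZR R u.2 / u.1%:R) / 4.
  by rewrite big_map mulr_suml; apply: eq_bigr => u _ /=; rewrite mulrAC.
move: (\sum_(u <- zweights) _) (\sum_(u <- zsteps) _) (ZR R 1000000) h0 => a b c c0.
have -> : - a * (1000 * c) + - (1107 * b) * c = (- a * 1000 - 1107 * b) * c by ring.
by rewrite ler_pM2r // => h; clear -h; lra.
Qed.

Definition psi_err (l : R) : R := 7 / 10 * l ^+ 2 + 127 / 100 * l.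

Lemma le_psi_err l m : 0 <= l -> l <= m -> psi_err l <= psi_err m.
Proof. by move=> l0 lm; rewrite /psi_err; nra. Qed.

(** [82] bounds the mass and [3] the negative of the sum of the weights. The jumps before [nrange]
    total [11/2], all at [d >= 80]; the last one is [141/4]. *)
Definition psi_low_err (l : R) : R :=
  82 * (l / 2 + 7 / 12) + 3 + 11 / 2 * psi_err (l - ln 80)
    + 141 / 4 * psi_err (l - ln nrange%:R).

Lemma step_mass (p q : R) :
  \sum_(u <- steps) u.2 * (if (u.1 < nrange)%N then p else q) = 11 / 2 * p + 141 / 4 * q.
Proof.
have ck : (zsum (fun u => if (u.1 < nrange)%N then u.2 else 0) zsteps =? 22)%BZ &&
    (zsum (fun u => if (u.1 < nrange)%N then 0 else u.2)%BZ zsteps =? 141)%BZ.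
  by vm_compute.
have /andP[/Z.eqb_eq c1 /Z.eqb_eq c2] := ck.
have -> : \sum_(u <- steps) u.2 * (if (u.1 < nrange)%N then p else q) =
  \sum_(u <- zsteps) (ZR R (if (u.1 < nrange)%N then u.2 else 0%BZ) * (p / 4)
   + ZR R (if (u.1 < nrange)%N then 0%BZ else u.2) * (q / 4)).
  rewrite big_map; apply: eq_bigr => u _ /=.
  by have z0 : ZR R 0 = 0 by []; case: ifP => _; rewrite z0; move: (ZR R u.2) => v; field.
rewrite big_split /= -!mulr_suml -!ZR_zsum c1 c2.
have -> : ZR R 22 = 22 by []. have -> : ZR R 141 = 141 by [].
by field.
Qed.

Lemma psi_div_le (N x y m : nat) : (0 < m <= x)%N -> (y <= x)%N -> (x < N)%N ->
  psi R N (y %/ m) <= 1107 / 1000 * (y%:R / m%:R) + psi_err (ln x%:R - ln m%:R).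
Proof.
move=> /andP[m0 mx] yx xN.
have m0R : 0 < m%:R :> R by rewrite ltr0n.
have x0 : (0 < x)%N by apply: leq_trans mx.
have d0 : 0 <= ln x%:R - ln m%:R :> R by rewrite subr_ge0 ln_nat_le.
have [ym|my] := ltnP y m.
  rewrite divn_small // psi0 addr_ge0 //.
    by rewrite mulr_ge0 ?divr_ge0.
  by rewrite /psi_err; nra.
have q0 : (0 < y %/ m)%N by rewrite divn_gt0.
have qN : (y %/ m < N)%N by apply: leq_ltn_trans (leq_div _ _) (leq_ltn_trans yx xN).
apply: le_trans (psi_le R q0 qN) _; apply: lerD.
  apply: ler_wpM2l; first by rewrite divr_ge0.
  by rewrite ler_pdivlMr // -natrM ler_nat leq_trunc_div.
apply: le_psi_err; first exact: ln_nat_ge0.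
rewrite -ln_div_nat // ler_ln ?posrE ?divr_gt0 ?ltr0n // ler_pdivlMr //.
by rewrite -natrM ler_nat (leq_trans (leq_trunc_div _ _)).
Qed.

Lemma psi_ge_arith (t l A B C d e p a b : R) :
  (3903 / 4000 + 1107 / 1000 * A) * t <= d -> e <= 82 * (l / 2 + 7 / 12) ->
  B <= 1107 / 1000 * t * A + (11 / 2 * a + 141 / 4 * b) -> - 3 <= C ->
  d + C - e <= p + B ->
  3903 / 4000 * t - (82 * (l / 2 + 7 / 12) + 3 + 11 / 2 * a + 141 / 4 * b) <= p.
Proof. by move=> *; lra. Qed.

(** The error is taken at [x] so that one bound serves all [y] of a later partial summation;
    [y >= 200] puts every weight in range. *)
Lemma psi_ge (N x y : nat) : (200 <= y <= x)%N -> (nrange <= x)%N -> (x < N)%N ->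
  3903 / 4000 * y%:R - psi_low_err (ln x%:R) <= psi R N y.
Proof.
move=> /andP[y200 yx] nx xN; have y0 : (0 < y)%N by apply: leq_trans y200.
have yN : (y < N)%N by apply: leq_ltn_trans xN.
have wr u : u \in weights -> (0 < u.1 <= y)%N.
  by move=> /weights_range /andP[-> u2]; apply: leq_trans u2 y200.
have sr u : u \in steps -> (0 < u.1)%N.
  by move=> /steps_range[/andP[u1 _] _]; apply: leq_trans u1.
have main := psi_ge_weighted yN weights_zero_sum wr sr (fun z _ => floor_sum_weights_le z).
have st : \sum_(u <- steps) u.2 * psi R N (y %/ u.1) <=
    1107 / 1000 * y%:R * (\sum_(u <- steps) u.2 / u.1%:R) +
    (11 / 2 * psi_err (ln x%:R - ln 80) + 141 / 4 * psi_err (ln x%:R - ln nrange%:R)).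
  rewrite -step_mass mulr_sumr -big_split !big_seq; apply: ler_sum => u us.
  have [/andP[u80 un] w0] := steps_range us.
  have u0 := sr _ us.
  have ux : (0 < u.1 <= x)%N by rewrite u0 (leq_trans un).
  apply: (@le_trans _ _ (u.2 * (1107 / 1000 * (y%:R / u.1%:R) + psi_err (ln x%:R - ln u.1%:R)))).
    by apply: ler_wpM2l => //; apply: psi_div_le.
  rewrite mulrDr; apply: lerD.
    by rewrite le_eqVlt; apply/orP; left; apply/eqP; ring.
  apply: ler_wpM2l => //; apply: (@le_trans _ _ (psi_err (ln x%:R - ln (if (u.1 < nrange)%N then 80 else nrange)%:R))).
    apply: le_psi_err.
      by rewrite subr_ge0 ln_nat_le //; case/andP: ux.
    rewrite lerD2l lerN2; apply: ln_nat_le; first by case: ifP.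
    by case: ifP => // /negbT; rewrite -leqNgt.
  by case: ifP.
have lyx : ln y%:R <= ln x%:R :> R by apply: ln_nat_le.
have ly0 : 0 <= ln y%:R :> R by apply: ln_nat_ge0.
have ms : mass weights * (ln y%:R / 2 + 7 / 12) <= 82 * (ln x%:R / 2 + 7 / 12).
  have m0 := mass_weights; apply: le_trans (_ : 82 * (ln y%:R / 2 + 7 / 12) <= _).
    by apply: ler_wpM2r => //; lra.
  by lra.
have lm : (3903 / 4000 + 1107 / 1000 * (\sum_(u <- steps) u.2 / u.1%:R)) * y%:R <= log_mean weights * y%:R.
  by apply: ler_wpM2r; [exact: ler0n | exact: log_mean_ge].
exact: (psi_ge_arith lm ms st sum_weights_ge main).
Qed.
End PsiLower.

(** * Prime counting *)

Section PrimeCount.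
Variable R : realType.

Definition pcount (N : nat) (P : pred nat) : R :=
  \sum_(0 <= p < N | prime p) (P p)%:R.

Lemma sum_prime_powers (N p x : nat) : prime p -> (0 < x < N)%N ->
  \sum_(1 <= i < N) ln p%:R * (0 < x %/ p ^ i)%N%:R = (trunc_log p x)%:R * ln p%:R :> R.
Proof.
move=> pp /andP[x0 xN]; have p1 := prime_gt1 pp.
set k := trunc_log p x.
have kN : (k < N)%N.
  apply: leq_ltn_trans xN; apply: leq_trans (ltnW (ltn_expl k p1)) _.
  exact: trunc_logP.
have ki i : (0 < x %/ p ^ i)%N = (i <= k)%N.
  rewrite divn_gt0 ?expn_gt0 ?prime_gt0 //.
  apply/idP/idP => [|ik]; first exact: trunc_log_max.
  by apply: leq_trans (trunc_logP p1 x0); rewrite leq_pexp2l // prime_gt0.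
rewrite -mulr_sumr mulrC; congr (_ * _).
rewrite (big_cat_nat (n := k.+1)) //= [X in _ + X]big_nat_cond [X in _ + X]big1; last first.
  by move=> i /andP[/andP[ki1 _] _]; rewrite ki leqNgt ki1.
rewrite addr0 big_nat_cond (eq_bigr (fun=> 1)).
  by rewrite -big_nat_cond sumr_const_nat subSS subn0.
by move=> i /andP[/andP[_ ik] _]; rewrite ki -ltnS ik.
Qed.

Definition ppow (N p x : nat) : R := \sum_(1 <= i < N) ln p%:R * (0 < x %/ p ^ i)%N%:R.

Lemma psiE N x : psi R N x = \sum_(0 <= p < N | prime p) ppow N p x.
Proof. by []. Qed.

Lemma ppow_ge0 N p x : 0 <= ppow N p x.
Proof. by apply: sumr_ge0 => i _; rewrite mulr_ge0 ?ln_nat_ge0. Qed.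

Lemma ppow_big N p x : prime p -> (x < p)%N -> ppow N p x = 0.
Proof.
move=> pp xp; rewrite /ppow big_nat_cond big1 // => i /andP[/andP[i1 _] _].
rewrite divn_small ?mulr0 //; apply: leq_trans xp _.
by rewrite -{1}(expn1 p) leq_exp2l // prime_gt1.
Qed.

Lemma ppow_le N p x : prime p -> (0 < x < N)%N -> ppow N p x <= ln x%:R.
Proof.
move=> pp xN; have /andP[x0 _] := xN.
rewrite /ppow sum_prime_powers // -lnXn_nat ln_nat_le //.
  by rewrite expn_gt0 prime_gt0.
exact: trunc_logP (prime_gt1 pp) x0.
Qed.

Lemma ppow_mid N p x : prime p -> (p <= x < N)%N -> (x < p ^ 2)%N ->
  ppow N p x = ln p%:R.
Proof.
move=> pp /andP[px xN] xp2; have x0 : (0 < x)%N by apply: leq_trans px; apply: prime_gt0.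
rewrite /ppow sum_prime_powers ?x0 // (@trunc_log_eq p 1 x) ?mul1r ?prime_gt1 //.
by rewrite expn1 px.
Qed.

(* The terms with [a >= p M / x] telescope to at most [ln (x / p)]; summed over
   the primes [p] this expresses [ln x * pi x - psi x] through values of [pi]. *)
Lemma ln_ratio_ge_steps (M p x : nat) : (0 < M)%N -> (0 < p <= x)%N ->
  \sum_(1 <= a < M) (ln a.+1%:R - ln a%:R) * (p <= a * x %/ M)%N%:R <= ln x%:R - ln p%:R :> R.
Proof.
move=> M0 /andP[p0 px]; have x0 : (0 < x)%N by apply: leq_trans px.
(* [tau = ln (p M / x)], and the sum is compared with the increments of the positive part of
   [ln a - tau]. *)
pose tau : R := ln p%:R + ln M%:R - ln x%:R.
pose g (a : nat) : R := Num.max 0 (ln a%:R - tau).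
have g0 a : 0 <= g a by rewrite /g le_max lexx.
apply: (@le_trans _ _ (g M - g 1%N)).
  rewrite -telescope_sumr //; rewrite !big_nat; apply: ler_sum => a /andP[a1 aM].
  have la : ln a%:R <= ln a.+1%:R :> R by apply: ln_nat_le.
  case: (boolP (p <= a * x %/ M)%N) => pa; last first.
    rewrite mulr0 subr_ge0 /g ge_max le_max lexx /= le_max.
    by apply/orP; right; rewrite lerD2r.
  have ta : tau <= ln a%:R.
    rewrite lerBlDr -!lnM_nat // ln_nat_le ?muln_gt0 ?p0 //.
    by move: pa; rewrite leq_divRL.
  by rewrite mulr1 /g !max_r ?subr_ge0 // ?(le_trans ta) //; lra.
have : g M = ln x%:R - ln p%:R.
  rewrite /g /tau max_r; first by ring.
  by have := @ln_nat_le R p x p0 px; lra.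
by have := g0 1%N; lra.
Qed.

(** Prime by prime. If [p > x] all terms vanish; if [p^2 <= x] the powers of [p] give at most [ln x]
    and the brackets are nonpositive; otherwise [p] gives [ln p] and [ln_ratio_ge_steps] supplies
    [ln x - ln p]. *)
Lemma prime_count_ge_psi (N M x : nat) : (0 < M)%N -> (0 < x < N)%N ->
  psi R N x + \sum_(1 <= a < M) (ln a.+1%:R - ln a%:R) *
     (pcount N (fun p => p <= a * x %/ M)%N - pcount N (fun p => p ^ 2 <= x)%N)
  <= pcount N (fun p => p <= x)%N * ln x%:R.
Proof.
move=> M0 xN; have /andP[x0 xlN] := xN.
under eq_bigr => a _ do rewrite -sumrB mulr_sumr.
rewrite exchange_big /= psiE -big_split mulr_suml; apply: ler_sum => p pp /=.
have p0 := prime_gt0 pp.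
have L0 := @ln_nat_ge0 R x.
have u0 a : (1 <= a)%N -> 0 <= ln a.+1%:R - ln a%:R :> R.
  by move=> a1; rewrite subr_ge0 ln_nat_le.
have [px|xp] := leqP p x; last first.
  rewrite ppow_big // add0r mul0r big_nat_cond; apply: sumr_le0 => a /andP[/andP[a1 aM] _].
  have -> : (p <= a * x %/ M)%N = false.
    apply/negbTE; rewrite -ltnNge (leq_ltn_trans _ xp) //.
    by rewrite -[X in (_ <= X)%N](mulKn x M0) leq_div2r // leq_mul2r ltnW ?orbT.
  have -> : (p ^ 2 <= x)%N = false.
    by apply/negbTE; rewrite -ltnNge (leq_trans xp) // -{1}(expn1 p) leq_pexp2l.
  by rewrite subrr mulr0.
rewrite mul1r; have [px2|xp2] := leqP (p ^ 2) x.
  have := @ppow_le N p x pp xN; have : \sum_(1 <= a < M) (ln a.+1%:R - ln a%:R) *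
     ((p <= a * x %/ M)%N%:R - 1) <= 0 :> R.
    rewrite big_nat_cond; apply: sumr_le0 => a /andP[/andP[a1 aM] _].
    apply: mulr_ge0_le0; first exact: u0.
    by case: (p <= _)%N; rewrite ?mulr1n ?mulr0n; lra.
  by move: (ln x%:R) (ppow _ _ _) (\sum_(_ <= a < _) _) => l q b *; lra.
rewrite ppow_mid ?px //.
have := @ln_ratio_ge_steps M p x M0 ltac:(by rewrite p0).
under [X in _ -> _ + X <= _]eq_bigr => a _ do rewrite subr0.
by move: (\sum_(_ <= a < _) _) (ln x%:R) (ln p%:R) => *; lra.
Qed.

(** Prime by prime: for [p < n] with [p^2 > x] the two values of [psi] cancel, and any other prime
    contributes at most [ln x], which one of the two counts pays. *)
Lemma interval_count_ge_psi (N n x : nat) : (0 < n)%N -> (n <= x < N)%N ->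
  psi R N x - pcount N (fun p => p ^ 2 <= x)%N * ln x%:R - psi R N n <=
  pcount N (fun p => n <= p <= x)%N * ln x%:R.
Proof.
move=> n0 /andP[nx xN]; have x0 : (0 < x)%N by apply: leq_trans nx.
have L0 := @ln_nat_ge0 R x.
rewrite !psiE !mulr_suml -!sumrB; apply: ler_sum => p pp /=.
have p0 := prime_gt0 pp.
have q0 := @ppow_ge0 N p n.
have [px|xp] := leqP p x; last first.
  rewrite ppow_big // andbF mul0r.
  have : 0 <= (p ^ 2 <= x)%N%:R * ln x%:R :> R by rewrite mulr_ge0.
  by move: q0; move: (_ * ln x%:R) (ppow N p n) => *; lra.
have le := @ppow_le N p x pp ltac:(by rewrite x0).
rewrite andbT; have [np|pn] := leqP n p.
  have : 0 <= (p ^ 2 <= x)%N%:R * ln x%:R :> R by rewrite mulr_ge0.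
  rewrite mul1r; move: le q0; move: (_ * ln x%:R) => ?; move: (ln x%:R) => ?.
  by move: (ppow N p x) (ppow N p n) => *; lra.
rewrite mul0r; have [px2|xp2] := leqP (p ^ 2) x.
  rewrite mul1r; move: le q0; move: (ln x%:R) => ?.
  by move: (ppow N p x) (ppow N p n) => *; lra.
rewrite mul0r subr0 !ppow_mid ?px ?(ltnW pn) ?(leq_ltn_trans nx) //.
by rewrite subrr.
Qed.

Lemma interval_count_ge_pcount (N n x : nat) : (n <= N)%N ->
  pcount N (fun p => p <= x)%N - n%:R <= pcount N (fun p => n <= p <= x)%N.
Proof.
move=> nN; rewrite lerBlDr -lerBlDl -sumrB.
apply: (@le_trans _ _ (\sum_(0 <= p < N) (p < n)%N%:R)).
  rewrite big_mkcond; apply: ler_sum => p _.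
  by case: ifP => // _; case: (ltnP p n) => pn; case: (p <= x)%N => /=; lra.
rewrite (big_cat_nat (n := n)) //= [X in _ + X]big_nat_cond [X in _ + X]big1.
  rewrite addr0 -[X in _ <= X%:R]subn0 -sumr_const_nat big_nat_cond [X in _ <= X]big_nat_cond.
  by apply: ler_sum => p /andP[/andP[_ pn] _]; rewrite pn.
by move=> p /andP[/andP[np _] _]; rewrite ltnNge np.
Qed.

(** Primes other than 2 and 3 are 1 or 5 modulo 6. *)
Lemma prime_count_le_third n : (3 * \sum_(0 <= p < n | prime p) 1 <= n + 4)%N.
Proof.
(* The term [1 < n] on the left accounts for 1, which has residue 1 without being prime. *)
have h : (\sum_(0 <= p < n | prime p) 1 + (1 < n) <= 2 * (n %/ 6) + (1 < n %% 6) + (2 < n) + (3 < n))%N.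
  elim: n => [|n IH]; first by rewrite big_geq.
  rewrite big_mkcond big_nat_recr //= -big_mkcond /=.
  have : (prime n -> [|| n == 2, n == 3, n %% 6 == 1 | n %% 6 == 5])%N.
    move=> pn; have d2 : (2 %| n)%N = (n == 2)%N by rewrite dvdn_prime2 // eq_sym.
    have d3 : (3 %| n)%N = (n == 3)%N by rewrite dvdn_prime2 // eq_sym.
    rewrite -d2 -d3; lia.
  have : prime n -> (1 < n)%N by exact: prime_gt1.
  case: (prime n) => [/(_ isT) n1 /(_ isT) h|_ _]; move: IH; lia.
lia.
Qed.

Lemma small_prime_count_le (N x r : nat) : (x < r.+1 ^ 2)%N ->
  pcount N (fun p => p ^ 2 <= x)%N <= (r%:R + 5) / 3.
Proof.
move=> xr; rewrite ler_pdivlMr // mulrC.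
have := prime_count_le_third r.+1; rewrite addSnnS -(ler_nat R) natrM natrD natr_sum.
apply: le_trans; rewrite ler_wpM2l // /pcount.
rewrite [X in _ <= X]big_mkcond [X in X <= _]big_mkcond.
have [Nr|rN] := leqP N r.+1.
  rewrite [X in _ <= X](big_cat_nat (n := N)) //=.
  rewrite -[X in X <= _]addr0 lerD ?sumr_ge0 // => [|p _]; last by case: ifP.
  by apply: ler_sum => p _; case: ifP => // _; case: (_ <= x)%N.
rewrite [X in X <= _](big_cat_nat (n := r.+1)) ?(ltnW rN) //=.
rewrite [X in _ + X <= _]big_nat_cond [X in _ + X <= _]big1 ?addr0.
  by apply: ler_sum => p _; case: ifP => // _; case: (_ <= x)%N.
move=> p /andP[/andP[rp _] _]; case: ifP => // _.
by rewrite leqNgt (leq_trans xr) // leq_sqr.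
Qed.

Lemma sqrt_ex x : exists2 r : nat, (r ^ 2 <= x)%N & (x < r.+1 ^ 2)%N.
Proof.
elim: x => [|x [r rx xr]]; first by exists 0%N.
have [h|h] := ltnP x.+1 (r.+1 ^ 2); first by exists r => //; apply: leqW.
by exists r.+1 => //; apply: leq_ltn_trans xr _; rewrite ltn_sqr.
Qed.
End PrimeCount.

(** * Explicit lower bounds for psi *)

Section Analytic.
Variable R : realType.

(* Since [ln r <= 2 (sqrt r - 1)], one has [m <= m0 * sqrt r]. *)
Lemma ln_growth (r m0 m : R) : 1 <= r -> 2 <= m0 -> 0 <= m -> m <= m0 + ln r ->
  m ^+ 2 <= m0 ^+ 2 * r /\ m <= m0 * r.
Proof.
move=> r1 m02 m_ge0 le.
have r0 : 0 <= r by lra.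
set q := Num.sqrt r; have qr : q ^+ 2 = r by rewrite sqr_sqrtr.
have q1 : 1 <= q by rewrite /q -sqrtr1 ler_sqrt //; lra.
have lq : ln r <= 2 * (q - 1).
  rewrite -qr lnXn; last by lra.
  by have := @ln_le_sub1 R q ltac:(lra); rewrite mulr2n; lra.
have mq : m <= m0 * q by nra.
split; last by rewrite -qr; nra.
by rewrite -qr -exprMn lerXn2r ?nnegrE //; nra.
Qed.

(** With [r = x / X], each logarithm is at most its value at [X] plus [ln r], so by [ln_growth] its
    square grows at most linearly in [r]: the relative error at [X] persists beyond [X]. *)
Lemma psi_low_err_le (l r l0 m1 m2 : R) : 1 <= r -> 2 <= l0 -> 2 <= m1 -> 2 <= m2 ->
  l <= l0 + ln r -> 0 <= l - ln nrange%:R -> ln 80 <= ln nrange%:R :> R ->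
  l0 - ln 80 <= m1 -> l0 - ln nrange%:R <= m2 ->
  psi_low_err l <= (82 * (l0 / 2 + 7 / 12) + 3 + 11 / 2 * psi_err m1 + 141 / 4 * psi_err m2) * r.
Proof.
have := @ln_nat_ge0 R 80; rewrite /psi_low_err /psi_err.
move: (ln 80) (ln nrange%:R) => a b a0 r1 l02 m12 m22 ll lb ab h1 h2.
have [_ g0] := @ln_growth r l0 l r1 l02 ltac:(lra) ll.
have [g1 g2] := @ln_growth r m1 (l - a) r1 m12 ltac:(lra) ltac:(lra).
have [g3 g4] := @ln_growth r m2 (l - b) r1 m22 ltac:(lra) ltac:(lra).
move: g1 g2 g3 g4; move: ((l - a) ^+ 2) ((l - b) ^+ 2) (m1 ^+ 2) (m2 ^+ 2) => *.
nra.
Qed.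

Definition err_const (l0 m1 m2 : R) : R :=
  82 * (l0 / 2 + 7 / 12) + 3 + 11 / 2 * psi_err m1 + 141 / 4 * psi_err m2.

Lemma psi_ge_rel (X x y N : nat) (l0 m1 m2 E : R) :
  (nrange <= X)%N -> (X <= x)%N -> (x < N)%N -> (200 <= y <= x)%N ->
  ln X%:R <= l0 -> 2 <= l0 -> 2 <= m1 -> 2 <= m2 ->
  l0 - ln 80 <= m1 -> l0 - ln nrange%:R <= m2 -> err_const l0 m1 m2 <= E ->
  3903 / 4000 * y%:R - E * (x%:R / X%:R) <= psi R N y.
Proof.
move=> nX Xx xN yr lX l02 m12 m22 h1 h2 hE.
have n0 : (0 < nrange)%N by [].
have X0 : (0 < X)%N by apply: leq_trans nX.
have X0R : 0 < X%:R :> R by rewrite ltr0n.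
have x0 : (0 < x)%N by apply: leq_trans Xx.
have r1 : 1 <= x%:R / X%:R :> R by rewrite ler_pdivlMr // mul1r ler_nat.
apply: le_trans (psi_ge R yr (leq_trans nX Xx) xN).
rewrite lerD2l lerN2; apply: (@le_trans _ _ (err_const l0 m1 m2 * (x%:R / X%:R))).
  apply: psi_low_err_le => //.
  - rewrite ln_div_nat //; move: lX; move: (ln X%:R) (ln x%:R) => a b; clear; lra.
  - by rewrite subr_ge0 ln_nat_le // (leq_trans nX).
  - exact: ln_nat_le.
by apply: ler_wpM2r => //; apply: le_trans r1.
Qed.

(** 270000, where the sieve hands over to the estimates; sharper constants take over at [far_bound],
    2000000. *)
Definition near_bound : nat := 135 * (20 * 100).
Definition far_bound : nat := 200 * (100 * 100).

Lemma ln_numeric_arith (l80 l100 l200 l135 l20 u v w : R) :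
  2191 / 500 <= l80 -> 921 / 200 <= l100 -> 2649 / 500 <= l200 ->
  l100 <= 2303 / 500 -> l200 <= 53 / 10 -> l135 <= 2453 / 500 ->
  l20 <= 749 / 250 -> 49 / 10 <= l135 -> 599 / 200 <= l20 ->
  u = l200 + l100 -> v = l135 + (l20 + l100) -> w = l200 + (l100 + l100) ->
  (2191 / 500 <= l80 /\ 99 / 10 <= u) /\
  (125 / 10 <= v /\ v <= 3127 / 250) /\ (145 / 10 <= w /\ w <= 1814 / 125).
Proof.
move=> h1 h2 h3 h4 h5 h6 h7 h8 h9 -> -> ->.
split; [split|split; split]; [exact: h1|clear -h2 h3|clear -h2 h8 h9|clear -h4 h6 h7|clear -h2 h3|clear -h4 h5]; lra.
Qed.

Lemma ln_numeric_bounds :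
  (2191 / 500 <= ln 80 :> R /\ 99 / 10 <= ln nrange%:R :> R) /\
  (125 / 10 <= ln near_bound%:R :> R /\ ln near_bound%:R <= 3127 / 250 :> R) /\
  (145 / 10 <= ln far_bound%:R :> R /\ ln far_bound%:R <= 1814 / 125 :> R).
Proof.
have a1 : 2191 / 500 <= ln 80 :> R by apply: (@ln_tab_ge R 2191 500 80 isT isT); vm_compute.
have a2 : 921 / 200 <= ln 100 :> R by apply: (@ln_tab_ge R 921 200 100 isT isT); vm_compute.
have a3 : 2649 / 500 <= ln 200 :> R by apply: (@ln_tab_ge R 2649 500 200 isT isT); vm_compute.
have a4 : ln 100 <= 2303 / 500 :> R by apply: (@ln_tab_le R 2303 500 100 isT isT); vm_compute.
have a5 : ln 200 <= 53 / 10 :> R by apply: (@ln_tab_le R 53 10 200 isT isT); vm_compute.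
have a6 : ln 135 <= 2453 / 500 :> R by apply: (@ln_tab_le R 2453 500 135 isT isT); vm_compute.
have a7 : ln 20 <= 749 / 250 :> R by apply: (@ln_tab_le R 749 250 20 isT isT); vm_compute.
have a8 : 49 / 10 <= ln 135 :> R by apply: (@ln_tab_ge R 49 10 135 isT isT); vm_compute.
have a9 : 599 / 200 <= ln 20 :> R by apply: (@ln_tab_ge R 599 200 20 isT isT); vm_compute.
have e1 : ln nrange%:R = ln 200 + ln 100 :> R by rewrite (@lnM_nat R 200 100).
have e2 : ln near_bound%:R = ln 135 + (ln 20 + ln 100) :> R.
  by rewrite (@lnM_nat R 135 (20 * 100)) // (@lnM_nat R 20 100).
have e3 : ln far_bound%:R = ln 200 + (ln 100 + ln 100) :> R.
  by rewrite (@lnM_nat R 200 (100 * 100)) // (@lnM_nat R 100 100).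
exact: (ln_numeric_arith a1 a2 a3 a4 a5 a6 a7 a8 a9 e1 e2 e3).
Qed.

(** [1160 / 270000 < 0.00431]; the slack yields the [+ 1], which will absorb the rounding of
    [y = floor (a x / 100)]. *)
Lemma psi_ge_near (N x y : nat) : (near_bound <= x)%N -> (x < N)%N -> (200 <= y <= x)%N ->
  3903 / 4000 * y%:R - 431 / 1000 / 100 * x%:R + 1 <= psi R N y.
Proof.
move=> Xx xN yr; have [[a1 a2] [[b0 b1] _]] := ln_numeric_bounds.
have X1E : near_bound%:R = 135 * (20 * 100) :> R by rewrite !natrM.
have Xr : 135 * (20 * 100) <= x%:R :> R by rewrite -X1E ler_nat.
have nX : (nrange <= near_bound)%N by vm_compute.
(* The arguments bound [ln 270000] and its excess over [ln 80] and over [ln 20000]. *)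
have c1 : err_const (3127 / 250) (4063 / 500) (326 / 125) <= 1160 :> R.
  by rewrite /err_const /psi_err; clear; lra.
have c2 : 2 <= 3127 / 250 :> R by clear; lra.
have c3 : 2 <= 4063 / 500 :> R by clear; lra.
have c4 : 2 <= 326 / 125 :> R by clear; lra.
have c5 : 3127 / 250 - ln 80 <= 4063 / 500 :> R.
  by move: a1; clear; move: (ln 80) => u *; lra.
have c6 : 3127 / 250 - ln nrange%:R <= 326 / 125 :> R.
  by move: a2; clear; move: (ln nrange%:R) => u *; lra.
apply: le_trans (psi_ge_rel nX Xx xN yr b1 c2 c3 c4 c5 c6 c1).
rewrite X1E; move: (x%:R : R) (y%:R : R) Xr => u v ur; clear -ur.
have -> : 1160 * (u / (135 * (20 * 100))) = 116 / 270 / 100 * u by field.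
lra.
Qed.

Lemma psi_ge_far (N x y : nat) : (far_bound <= x)%N -> (x < N)%N -> (200 <= y <= x)%N ->
  3903 / 4000 * y%:R - 93 / 1000 / 100 * x%:R + 1 <= psi R N y.
Proof.
move=> Xx xN yr; have [[a1 a2] [_ [b0 b1]]] := ln_numeric_bounds.
have X1E : far_bound%:R = 200 * (100 * 100) :> R by rewrite !natrM.
have Xr : 200 * (100 * 100) <= x%:R :> R by rewrite -X1E ler_nat.
have nX : (nrange <= far_bound)%N by vm_compute.
have c1 : err_const (1814 / 125) (1013 / 100) (1153 / 250) <= 1850 :> R.
  by rewrite /err_const /psi_err; clear; lra.
have c2 : 2 <= 1814 / 125 :> R by clear; lra.
have c3 : 2 <= 1013 / 100 :> R by clear; lra.
have c4 : 2 <= 1153 / 250 :> R by clear; lra.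
have c5 : 1814 / 125 - ln 80 <= 1013 / 100 :> R.
  by move: a1; clear; move: (ln 80) => u *; lra.
have c6 : 1814 / 125 - ln nrange%:R <= 1153 / 250 :> R.
  by move: a2; clear; move: (ln nrange%:R) => u *; lra.
apply: le_trans (psi_ge_rel nX Xx xN yr b1 c2 c3 c4 c5 c6 c1).
rewrite X1E; move: (x%:R : R) (y%:R : R) Xr => u v ur; clear -ur.
have -> : 1850 * (u / (200 * (100 * 100))) = 185 / 2000 / 100 * u by field.
lra.
Qed.

End Analytic.

(** * Discrete partial summation *)

Section Increments.
Variable R : realType.

Definition ln_inc (a : nat) : R := ln a.+1%:R - ln a%:R.

(** Integer lower bounds for [a * ln_inc a], in units of [10^-9], and, in [zinc2], for its product
    with [ln 100 - ln a], in units of [10^-18]. *)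
Definition zinc1 (a : nat) : Z := (Z.of_nat a * ln_step_lo (Z.of_nat a))%BZ.
Definition zinc2 (a : nat) : Z :=
  (Z.of_nat a * ln_step_lo (Z.of_nat a) *
   ((nth (0, 0) ln_tab 100.-1).1 - (nth (0, 0) ln_tab a.-1).2))%BZ.

Lemma zinc_checks :
  Z.leb (967 * 100000000) (zsum zinc1 (index_iota 1 100)) &&
  Z.leb (915 * 100000000000000000) (zsum zinc2 (index_iota 1 100)).
Proof. by vm_compute. Qed.

(** A Riemann sum for the integral of 1 over [[0, 1]], with [u = a / 100]; [sum_ln_inc_log_ge] does
    the same for [- ln u]. Both integrals are 1, and 100 steps retain [0.967] and [0.915]. *)
Lemma sum_ln_inc_ge : 967 / 1000 <= \sum_(1 <= a < 100) ln_inc a * (a%:R / 100).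
Proof.
have /andP[/Z.leb_le h _] := zinc_checks.
have c0 : 0 < ZR R 100000000 by apply: (@ZR_lt R 0).
have sc : ZR R ln_scale = 10 * ZR R 100000000.
  have -> : ln_scale = (10 * 100000000)%BZ by [].
  have e3 : ZR R 10 = 10 by [].
  by rewrite ZRM e3.
have e3 : ZR R 967 = 967 by [].
have h1 : {in index_iota 1 100, forall u, ZR R (zinc1 u) <=
    ln_inc u * (u%:R / 100) * (100 * (10 * ZR R 100000000))}.
  move=> a; rewrite mem_index_iota => /andP[a1 _].
  have /andP[lo _] := @ln_stepP R a a1.
  have -> : ln_inc a * (a%:R / 100) * (100 * (10 * ZR R 100000000)) = a%:R * (ZR R ln_scale * ln_inc a).
    by rewrite sc; move: (ZR R 100000000) (ln_inc a) => c b; field.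
  by rewrite /zinc1 ZRM ZR_nat ler_wpM2l.
have := ZR_le R h; rewrite [X in X <= _ -> _]ZRM e3 => /le_trans /(_ (ZR_zsum_le h1)).
rewrite -mulr_suml; move: (\sum_(1 <= a < 100) _) (ZR R 100000000) c0 => S c c0; clear -c0.
have -> : S * (100 * (10 * c)) = S * 1000 * c by ring.
by rewrite ler_pM2r // => h; lra.
Qed.

Lemma ln_inc_ge0 a : (0 < a)%N -> 0 <= ln_inc a.
Proof. by move=> a0; rewrite subr_ge0 ln_nat_le. Qed.

Lemma ln_step_lo_ge0 (a : nat) : (0 <= ln_step_lo (Z.of_nat a))%BZ.
Proof.
rewrite /ln_step_lo; have : (0 <= ln_scale)%BZ by [].
by move: ln_scale => c c0; apply: Z.div_pos; nia.
Qed.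

Lemma sum_ln_inc_log_arith (k c u L l a : R) : k * k = 10 * c ->
  u * (L - l) * (a / 100) * (1000 * c) = a * ((k * u) * (k * L - k * l)).
Proof.
move=> kc; transitivity (a * u * (L - l) * (k * k)); last by ring.
by rewrite kc; field.
Qed.

Lemma sum_ln_inc_log_ge : 915 / 1000 <=
  \sum_(1 <= a < 100) ln_inc a * (ln 100 - ln a%:R) * (a%:R / 100).
Proof.
have /andP[_ /Z.leb_le h] := zinc_checks.
have c0 : 0 < ZR R 100000000000000000 by apply: (@ZR_lt R 0).
have sc : ZR R ln_scale * ZR R ln_scale = 10 * ZR R 100000000000000000.
  have e3 : ZR R 10 = 10 by [].
  by rewrite -e3 -!ZRM.
have e3 : ZR R 915 = 915 by [].
have h1 : {in index_iota 1 100, forall u, ZR R (zinc2 u) <=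
    ln_inc u * (ln 100 - ln u%:R) * (u%:R / 100) * (1000 * ZR R 100000000000000000)}.
  move=> a; rewrite mem_index_iota => /andP[a1 a100].
  have /andP[lo _] := @ln_stepP R a a1.
  have := @ln_tabP R 100 isT; cbv zeta => /andP[l100 _].
  have ar : (0 < a <= 200)%N by rewrite a1 (leq_trans (ltnW a100)).
  have := @ln_tabP R a ar; cbv zeta => /andP[_ ha].
  have -> : ln_inc a * (ln 100 - ln a%:R) * (a%:R / 100) * (1000 * ZR R 100000000000000000)
     = a%:R * ((ZR R ln_scale * ln_inc a) * (ZR R ln_scale * ln 100 - ZR R ln_scale * ln a%:R)).
    exact: sum_ln_inc_log_arith.
  rewrite /zinc2; move: l100 ha.
  move: (nth (0, 0)%BZ ln_tab 100.-1).1 (nth (0, 0)%BZ ln_tab a.-1).2 => t q l100 ha.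
  move: (ln_step_lo _) lo (@ln_step_lo_ge0 a) => st lo st0.
  rewrite !ZRM ZRB ZR_nat -mulrA.
  apply: ler_wpM2l; first exact: ler0n.
  have d0 : 0 <= ZR R ln_scale * ln 100 - ZR R ln_scale * ln a%:R.
    rewrite -mulrBr; apply: mulr_ge0; first exact: ln_scale_ge0.
    rewrite subr_ge0; exact: (ln_nat_le R a1 (ltnW a100)).
  apply: (@le_trans _ _ (ZR R st *
      (ZR R ln_scale * ln 100 - ZR R ln_scale * ln a%:R))); last exact: ler_wpM2r.
  apply: ler_wpM2l; last by apply: lerB.
  exact: ZR_ge0.
have := ZR_le R h; rewrite [X in X <= _ -> _]ZRM e3 => /le_trans /(_ (ZR_zsum_le h1)).
rewrite -mulr_suml; move: (\sum_(1 <= a < 100) _) (ZR R 100000000000000000) c0 => S c c0; clear -c0.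
have -> : S * (1000 * c) = S * 1000 * c by ring.
by rewrite ler_pM2r // => h; lra.
Qed.
End Increments.

(** * Lower bound for the number of primes up to x *)

Section PrimeLower.
Variable R : realType.

Lemma psi_le_pcount (N y : nat) : (0 < y < N)%N ->
  psi R N y <= pcount R N (fun p => p <= y)%N * ln y%:R.
Proof.
by move=> yN; have := @prime_count_ge_psi R N 1 y isT yN; rewrite big_geq // addr0.
Qed.

Lemma pcount_ge0 N P : 0 <= pcount R N P.
Proof. by apply: sumr_ge0 => p _; apply: ler0n. Qed.

(** [K^2 <= x] gives [sqrt x <= x / K], making the count of small primes a small multiple of [x]. *)
Lemma small_prime_count_rel (N x K : nat) : (0 < K)%N -> (K ^ 2 <= x)%N ->
  pcount R N (fun p => p ^ 2 <= x)%N <= x%:R / (3 * K%:R) + 5 / 3.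
Proof.
move=> K0 Kx; have [r rx xr] := sqrt_ex x.
apply: le_trans (small_prime_count_le R N xr) _.
have K0R : 0 < K%:R :> R by rewrite ltr0n.
have rK : r%:R <= x%:R / K%:R :> R.
  rewrite ler_pdivlMr // -natrM ler_nat; have [rK|Kr] := leqP r K.
    by apply: leq_trans Kx; rewrite leq_mul2r rK orbT.
  by apply: leq_trans rx; rewrite leq_mul2l ltnW ?orbT.
have -> : x%:R / (3 * K%:R) = x%:R / K%:R / 3 :> R by field; rewrite lt0r_neq0.
by move: (r%:R : R) (x%:R / K%:R) rK => a b *; lra.
Qed.

(** First-order form of [1 / (L - b)], from [(1 + b / L) (1 - b / L) <= 1]. *)
Lemma pcount_ge_of_log_le (L b P l S t : R) : 0 < L -> 0 <= b -> 0 <= P -> l <= L - b ->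
  S <= P * l -> t <= S -> 0 <= S -> t * (1 + b / L) / L <= P.
Proof.
move=> L0 b0 P0 lL SP tS S0; rewrite ler_pdivrMr //.
have c0 : 0 <= 1 + b / L by rewrite addr_ge0 // divr_ge0 // ltW.
apply: (@le_trans _ _ (S * (1 + b / L))); first exact: ler_wpM2r.
have SPL : S <= P * L by apply: le_trans SP _; apply: ler_wpM2l => //; lra.
have SbL : S * (b / L) <= P * b.
  have -> : P * b = P * L * (b / L) by field; apply: lt0r_neq0.
  by apply: ler_wpM2r => //; apply: divr_ge0 => //; apply: ltW.
have : P * l <= P * (L - b) by apply: ler_wpM2l.
lra.
Qed.

Lemma sum_ln_inc : \sum_(1 <= a < 100) ln_inc R a = ln 100.
Proof. by rewrite /ln_inc telescope_sumr // ln1 subr0. Qed.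

(** In [prime_count_ge_psi] with [M = 100], each inner count at [y = floor (a x / 100)] is at least
    [psi y / ln y], and [ln y <= ln x - (ln 100 - ln a)] is expanded to first order. *)
Lemma pcount_ge (N x K : nat) (eta : R) :
  (nrange <= x)%N -> (x < N)%N -> (0 < K)%N -> (K ^ 2 <= x)%N -> 0 <= eta ->
  (forall y, (200 <= y <= x)%N -> 3903 / 4000 * y%:R - eta * x%:R + 1 <= psi R N y) ->
  3903 / 4000 * x%:R * (1 + 967 / 1000 / ln x%:R + 915 / 1000 / ln x%:R ^+ 2)
   - eta * x%:R * (1 + ln 100 * (1 + ln 100 / ln x%:R) / ln x%:R)
   - (x%:R / (3 * K%:R) + 5 / 3) * ln 100
  <= pcount R N (fun p => p <= x)%N * ln x%:R.
Proof.
move=> nx xN K0 Kx eta0 H; set L := ln x%:R; set m := ln 100.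
have n2 : (200 * 100 <= x)%N by [].
have x200 : (200 <= x)%N by apply: leq_trans n2; rewrite leq_pmulr.
have x0 : (0 < x)%N by apply: leq_trans x200.
have x0R : 0 < x%:R :> R by rewrite ltr0n.
have L0 : 0 < L by rewrite ln_gt0 // ltr1n (leq_trans _ x200).
have m0 : 0 <= m by apply: (@ln_nat_ge0 R 100).
have main := @prime_count_ge_psi R N 100 x isT ltac:(by rewrite x0).
apply: le_trans main.
set s := pcount R N (fun p => p ^ 2 <= x)%N.
have s0 : 0 <= s by apply: pcount_ge0.
have sle : s <= x%:R / (3 * K%:R) + 5 / 3 by apply: small_prime_count_rel.
have psix : 3903 / 4000 * x%:R - eta * x%:R <= psi R N x.
  have := H x ltac:(by rewrite x200 leqnn).
  by move: (psi R N x) (x%:R : R) => u v; clear => h; lra.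
have term a : (1 <= a < 100)%N ->
   3903 / 4000 * x%:R / L * (ln_inc R a * (a%:R / 100)) +
   3903 / 4000 * x%:R / L ^+ 2 * (ln_inc R a * (ln 100 - ln a%:R) * (a%:R / 100)) -
   eta * x%:R * (1 + m / L) / L * ln_inc R a - s * ln_inc R a
   <= ln_inc R a * (pcount R N (fun p => p <= a * x %/ 100)%N - s).
  move=> /andP[a1 a100]; set y := (a * x %/ 100)%N.
  have u0 := @ln_inc_ge0 R a a1.
  have y200 : (200 <= y)%N.
    by rewrite leq_divRL //; apply: leq_trans n2 _; rewrite leq_pmull.
  have yx : (y <= x)%N.
    by rewrite -[X in (_ <= X)%N](mulKn x (isT : 0 < 100)%N) leq_div2r // leq_mul2r ltnW ?orbT.
  have y0 : (0 < y)%N by apply: leq_trans y200.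
  have yN : (0 < y < N)%N by rewrite y0 (leq_ltn_trans yx).
  have b0 : 0 <= ln 100 - ln a%:R :> R by rewrite subr_ge0; apply: ln_nat_le => //; apply: ltnW.
  have bm : ln 100 - ln a%:R <= m by rewrite gerBl ln_nat_ge0.
  have ly : ln y%:R <= L - (ln 100 - ln a%:R).
    rewrite lerBrDr addrA lerBlDr -(@lnM_nat R y 100) // /L addrC -lnM_nat // ln_nat_le ?muln_gt0 ?y0 //.
    by rewrite leq_trunc_div.
  have yge : a%:R / 100 * x%:R - 1 <= y%:R :> R.
    have : (a * x < y.+1 * 100)%N by rewrite -ltn_divLR.
    rewrite -(ltr_nat R) !natrM -natr1; by move: (a%:R : R) (x%:R : R) (y%:R : R) => p q r; clear => h; lra.
  have Hy := H y ltac:(by rewrite y200).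
  have t1 : 3903 / 4000 * (a%:R / 100 * x%:R) - eta * x%:R <= psi R N y.
    move: yge Hy; clear; move: (psi R N y) (y%:R : R) (a%:R / 100 * x%:R) (eta * x%:R) => *; lra.
  have := pcount_ge_of_log_le L0 b0 (pcount_ge0 N _) ly (psi_le_pcount yN) t1 (psi_ge0 R N y).
  set P := pcount R N _; move=> hP.
  have hP2 : ln_inc R a * ((3903 / 4000 * (a%:R / 100 * x%:R) - eta * x%:R) * (1 + (ln 100 - ln a%:R) / L) / L)
     <= ln_inc R a * P by apply: ler_wpM2l.
  (* In the error term alone, [ln 100 - ln a] is replaced by its maximum [ln 100]. *)
  have hE : eta * x%:R * (1 + (ln 100 - ln a%:R) / L) / L * ln_inc R a <= eta * x%:R * (1 + m / L) / L * ln_inc R a.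
    apply: ler_wpM2r => //; apply: ler_wpM2r; first by rewrite invr_ge0 ltW.
    apply: ler_wpM2l; first by rewrite mulr_ge0 // ltW.
    by rewrite lerD2l; apply: ler_wpM2r => //; rewrite invr_ge0 ltW.
  have -> : ln_inc R a * (P - s) = ln_inc R a * P - s * ln_inc R a by ring.
  rewrite lerD2r; apply: le_trans hP2.
  apply: le_trans (_ : 3903 / 4000 * x%:R / L * (ln_inc R a * (a%:R / 100)) +
   3903 / 4000 * x%:R / L ^+ 2 * (ln_inc R a * (ln 100 - ln a%:R) * (a%:R / 100)) -
   eta * x%:R * (1 + (ln 100 - ln a%:R) / L) / L * ln_inc R a <= _).
    by rewrite lerD2l lerN2.
  rewrite le_eqVlt; apply/orP; left; apply/eqP; field.
  exact: lt0r_neq0.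
have sum : 3903 / 4000 * x%:R / L * (967 / 1000) + 3903 / 4000 * x%:R / L ^+ 2 * (915 / 1000)
   - eta * x%:R * (1 + m / L) / L * m - s * m <=
   \sum_(1 <= a < 100) ln_inc R a * (pcount R N (fun p => p <= a * x %/ 100)%N - s).
  apply: (@le_trans _ _ (\sum_(1 <= a < 100) (3903 / 4000 * x%:R / L * (ln_inc R a * (a%:R / 100)) +
   3903 / 4000 * x%:R / L ^+ 2 * (ln_inc R a * (ln 100 - ln a%:R) * (a%:R / 100)) -
   eta * x%:R * (1 + m / L) / L * ln_inc R a - s * ln_inc R a))); last first.
    by rewrite big_nat [X in _ <= X]big_nat; apply: ler_sum => a; apply: term.
  rewrite !sumrB big_split /= -!mulr_sumr sum_ln_inc.
  have k0 : 0 <= 3903 / 4000 * x%:R :> R by apply: mulr_ge0; [clear; lra | exact: ler0n].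
  have q1 : 0 <= 3903 / 4000 * x%:R / L by apply: divr_ge0 => //; apply: ltW.
  have q2 : 0 <= 3903 / 4000 * x%:R / L ^+ 2.
    by apply: divr_ge0 => //; apply: exprn_ge0; apply: ltW.
  rewrite !lerD2r; apply: lerD; apply: ler_wpM2l => //; [exact: sum_ln_inc_ge | exact: sum_ln_inc_log_ge].
have smle : s * m <= (x%:R / (3 * K%:R) + 5 / 3) * m by apply: ler_wpM2r.
move: psix sum smle; rewrite -/(ln_inc R).
move: (\sum_(1 <= a < 100) _) (psi R N x) (s * m) ((x%:R / (3 * K%:R) + 5 / 3) * m) => A1 B1 C1 D1.
have -> : 3903 / 4000 * x%:R * (1 + 967 / 1000 / L + 915 / 1000 / L ^+ 2) =
   3903 / 4000 * x%:R + 3903 / 4000 * x%:R / L * (967 / 1000) + 3903 / 4000 * x%:R / L ^+ 2 * (915 / 1000).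
  by field; apply: lt0r_neq0.
have -> : eta * x%:R * (1 + m * (1 + m / L) / L) = eta * x%:R + eta * x%:R * (1 + m / L) / L * m.
  by field; apply: lt0r_neq0.
move: (3903 / 4000 * x%:R / L * _) => a; move: (3903 / 4000 * x%:R / L ^+ 2 * _) => b.
move: (eta * x%:R * (1 + m / L) / L * m) => d; move: (3903 / 4000 * x%:R) => e.
by move: (eta * x%:R) => g; clear; lra.
Qed.
End PrimeLower.

(** * Large intervals *)

Section LargeArith.
Variable R : realType.

(** The linear bound gives [L / n <= sigma L / (L - tau)], and the cubic inequality compares this
    with a polynomial in [1 / L] like the one bounding the prime count. *)
Lemma ratio_le (L n sigma tau A0 A1 A2 : R) : 0 < L -> tau < L -> 0 < sigma -> 0 < n ->
  L <= sigma * n + tau ->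
  sigma * L ^+ 3 <= (A0 * L ^+ 2 + A1 * L + A2) * (L - tau) ->
  L / n <= A0 + A1 / L + A2 / L ^+ 2.
Proof.
move=> L0 tL s0 n0 Ln cub.
have d0 : 0 < L - tau by rewrite subr_gt0.
have -> : A0 + A1 / L + A2 / L ^+ 2 = (A0 * L ^+ 2 + A1 * L + A2) / L ^+ 2.
  by field; apply: lt0r_neq0.
apply: (@le_trans _ _ (sigma * L / (L - tau))).
  rewrite ler_pdivrMr // mulrAC ler_pdivlMr // -mulrA [L * n]mulrC mulrA [_ * L]mulrC.
  by apply: ler_wpM2l; [exact: ltW | lra].
rewrite ler_pdivrMr // mulrAC ler_pdivlMr ?exprn_gt0 //.
by rewrite -mulrA -exprS.
Qed.

(** Here [967/1000 < 151/154], so [L] must be bounded above; in [cubic_far] the leading coefficient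
    is positive. *)
Lemma cubic_near (L : R) : 125 / 10 <= L -> L <= 1814 / 125 ->
  151 / 154 * L ^+ 3 <= (967 / 1000 * L ^+ 2 + 923 / 1000 * L + 8 / 10) * (L - 725 / 1000).
Proof.
move=> h1 h2; rewrite -subr_ge0.
have -> : (967 / 1000 * L ^+ 2 + 923 / 1000 * L + 8 / 10) * (L - 725 / 1000) - 151 / 154 * L ^+ 3 =
  L ^+ 2 * ((967 / 1000 - 151 / 154) * L + (923 / 1000 - 967 / 1000 * (725 / 1000)))
  + L * (8 / 10 - 923 / 1000 * (725 / 1000)) - 8 / 10 * (725 / 1000) by ring.
have a1 : 2 / 100 <= (967 / 1000 - 151 / 154) * L + (923 / 1000 - 967 / 1000 * (725 / 1000)) by lra.
have a2 : 100 <= L ^+ 2 by nra.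
move: a1 a2; move: ((967 / 1000 - 151 / 154) * L + _) (L ^+ 2) => u v *.
have : 2 <= v * u by nra.
lra.
Qed.

Lemma cubic_far (L : R) : 145 / 10 <= L ->
  191 / 198 * L ^+ 3 <= (973 / 1000 * L ^+ 2 + 939 / 1000 * L + 87 / 100) * (L - 976 / 1000).
Proof.
move=> h1; rewrite -subr_ge0.
have -> : (973 / 1000 * L ^+ 2 + 939 / 1000 * L + 87 / 100) * (L - 976 / 1000) - 191 / 198 * L ^+ 3 =
  L * (L * ((973 / 1000 - 191 / 198) * L + (939 / 1000 - 973 / 1000 * (976 / 1000)))
  + (87 / 100 - 939 / 1000 * (976 / 1000))) - 87 / 100 * (976 / 1000) by ring.
have a1 : 1 / 10 <= (973 / 1000 - 191 / 198) * L + (939 / 1000 - 973 / 1000 * (976 / 1000)) by lra.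
move: a1; move: ((973 / 1000 - 191 / 198) * L + _) => u u1.
have b1 : 1 <= L * u by nra.
have : 1 / 2 <= L * u + (87 / 100 - 939 / 1000 * (976 / 1000)) by lra.
move: (L * u + _) => w w1; nra.
Qed.

(** After multiplication by [L], powers of [1 / L] are compared one by one. The slack [d x] absorbs
    [n L] and [5/3 ln 100 < 77/10]. *)
Lemma count_ge_pi_arith (x L n m P eta K A0 A1 A2 d : R) :
  0 < x -> 1 < L -> 0 < n -> 0 <= m -> m <= 2303 / 500 -> 0 <= eta -> 0 < K ->
  n * L + 77 / 10 <= d * x ->
  L / n <= A0 + A1 / L + A2 / L ^+ 2 ->
  A0 + d <= 3903 / 4000 - eta - 2303 / 500 / (3 * K) ->
  A1 <= 3903 / 4000 * (967 / 1000) - eta * (2303 / 500) ->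
  A2 <= 3903 / 4000 * (915 / 1000) - eta * (2303 / 500) ^+ 2 ->
  3903 / 4000 * x * (1 + 967 / 1000 / L + 915 / 1000 / L ^+ 2)
   - eta * x * (1 + m * (1 + m / L) / L) - (x / (3 * K) + 5 / 3) * m <= P * L ->
  x / n + n <= P.
Proof.
move=> x0 L1 n0 m0 mM eta0 K0 hd hL h0 h1 h2 hP.
have L0 : 0 < L by apply: lt_trans L1.
have M0 := le_trans m0 mM.
have iL : 0 < L^-1 by rewrite invr_gt0.
have iL2 : 0 < L ^- 2 by rewrite invr_gt0 exprn_gt0.
have iK : 0 < (3 * K)^-1 by rewrite invr_gt0 mulr_gt0.
rewrite -(ler_pM2r L0); apply: le_trans hP.
have e1 : (x / n + n) * L = x * (L / n) + n * L by field; apply: lt0r_neq0.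
have b1 : x * (L / n) <= x * (A0 + A1 / L + A2 / L ^+ 2) by apply: ler_wpM2l => //; apply: ltW.
have b2 : A1 / L <= (3903 / 4000 * (967 / 1000) - eta * (2303 / 500)) / L by rewrite ler_pM2r.
have b3 : A2 / L ^+ 2 <= (3903 / 4000 * (915 / 1000) - eta * (2303 / 500) ^+ 2) / L ^+ 2 by rewrite ler_pM2r.
have b4 : eta * (1 + m * (1 + m / L) / L) <=
    eta * (1 + 2303 / 500 / L + (2303 / 500) ^+ 2 / L ^+ 2).
  apply: ler_wpM2l => //.
  have -> : 1 + m * (1 + m / L) / L = 1 + m / L + m ^+ 2 / L ^+ 2 by field; apply: lt0r_neq0.
  apply: lerD; first by rewrite lerD2l ler_pM2r.
  by rewrite ler_pM2r // lerXn2r.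
have b5 : m * (3 * K)^-1 <= 2303 / 500 * (3 * K)^-1 by rewrite ler_pM2r.
pose g := A0 + A1 / L + A2 / L ^+ 2 + d.
have b6 : g <= 3903 / 4000 * (1 + 967 / 1000 / L + 915 / 1000 / L ^+ 2)
     - eta * (1 + m * (1 + m / L) / L) - m * (3 * K)^-1.
  rewrite /g.
  move: b2 b3 b4 b5 h0; move: (eta * (1 + m * _ / L)) => E.
  move: (m * (3 * K)^-1) (A1 / L) (A2 / L ^+ 2) => p q r.
  move: (3 * K)^-1 L^-1 (L ^- 2) => k l l2; clear; move=> *; lra.
have b7 := ler_wpM2l (ltW x0) b6.
rewrite e1.
have -> : 3903 / 4000 * x * (1 + 967 / 1000 / L + 915 / 1000 / L ^+ 2)
   - eta * x * (1 + m * (1 + m / L) / L) - (x / (3 * K) + 5 / 3) * m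
  = x * (3903 / 4000 * (1 + 967 / 1000 / L + 915 / 1000 / L ^+ 2)
     - eta * (1 + m * (1 + m / L) / L) - m * (3 * K)^-1) - 5 / 3 * m.
  by move: L^-1 (L ^- 2) (3 * K)^-1 => *; ring.
have : x * g = x * (A0 + A1 / L + A2 / L ^+ 2) + d * x by rewrite /g; ring.
move: b1 b7 hd mM; move: (x * g) (x * (L / n)) (x * (A0 + _ + _)) (n * L) (d * x) (x * (_ - _)).
clear => *; lra.
Qed.

Lemma ln_tangent (n m : nat) : (0 < n)%N -> (0 < m)%N ->
  ln n%:R <= ln m%:R + n%:R / m%:R - 1 :> R.
Proof.
move=> n0 m0; have := @ln_le_sub1 R (n%:R / m%:R) ltac:(by rewrite divr_gt0 ?ltr0n).
by rewrite ln_div_nat //; move: (ln n%:R) (ln m%:R) (n%:R / m%:R) => a b c; clear => h; lra.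
Qed.

Lemma tangent_consts :
  ln 14 - (ln 5 - ln 2) - 1 <= 725 / 1000 :> R /\ ln 18 - (ln 5 - ln 2) - 1 <= 976 / 1000 :> R.
Proof.
have a1 : ln 14 <= 264 / 100 :> R by apply: (@ln_tab_le R 264 100 14 isT isT); vm_compute.
have a2 : ln 18 <= 2891 / 1000 :> R by apply: (@ln_tab_le R 2891 1000 18 isT isT); vm_compute.
have [_ a3] := ln2_bounds R; have [a4 _] := ln5_bounds R.
move: (ln 14) (ln 18) (ln 2) (ln 5) a1 a2 a3 a4; clear => a b c d *.
by split; lra.
Qed.

(** The left side of the last inequality is at least [0.96 x - 1.107 n], while
    [(k - 1) L <= 2/3 (x - n)]; [x >= 2 n] decides. *)
Lemma count_ge_psi_arith (L n k x s p q C : R) : 2 <= k -> 0 < n -> 0 < L -> x = k * n ->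
  15 / 10 * L <= n -> 3903 / 4000 * x - 431 / 1000 / 100 * x <= p ->
  s * L <= 82 / 100 / 100 * x -> q <= 1107 / 1000 * n + 5 / 100 / 100 * x ->
  p - s * L - q <= C * L -> k - 1 <= C.
Proof.
move=> k2 n0 L0 -> nL hp hs hq hC; rewrite -(ler_pM2r L0); apply: le_trans hC.
have kL : (k - 1) * (15 / 10 * L) <= (k - 1) * n by apply: ler_wpM2l => //; lra.
move: hp hs kL; have kn : 2 * n <= k * n by rewrite ler_pM2r.
have -> : (k - 1) * (15 / 10 * L) = 15 / 10 * ((k - 1) * L) by ring.
have -> : (k - 1) * n = k * n - n by ring.
move: hq kn n0; move: (k * n) (s * L) ((k - 1) * L) => a b c; clear => *; lra.
Qed.

Lemma log_sq_le_near (x : nat) : (near_bound <= x)%N ->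
  ln x%:R ^+ 2 <= 58 / 1000 / 100 * x%:R :> R /\ 100 * 100 * ln x%:R <= 464 / 1000 * x%:R :> R.
Proof.
move=> Xx; have [_ [[b0 b1] _]] := ln_numeric_bounds R.
have X1E : near_bound%:R = 135 * (20 * 100) :> R by rewrite !natrM.
have X0 : (0 < near_bound)%N by [].
have X0R : 0 < near_bound%:R :> R by rewrite ltr0n.
have r1 : 1 <= x%:R / near_bound%:R :> R by rewrite ler_pdivlMr // mul1r ler_nat.
have x0 : (0 < x)%N by apply: leq_trans Xx.
have le : ln x%:R <= 3127 / 250 + ln (x%:R / near_bound%:R) :> R.
  rewrite ln_div_nat //; move: b1; move: (ln near_bound%:R) (ln x%:R) => a b; clear => h; lra.
have c2 : 2 <= 3127 / 250 :> R by clear; lra.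
have [h1 h2] := ln_growth r1 c2 (@ln_nat_ge0 R x) le.
move: h1 h2; rewrite X1E; move: (ln x%:R : R) (x%:R : R) (ler0n R x) => l u u0; clear -u0.
have -> : (3127 / 250) ^+ 2 * (u / (135 * (20 * 100))) = (3127 / 250) ^+ 2 / 2700 * (u / 100) by field.
have -> : 3127 / 250 * (u / (135 * (20 * 100))) = 3127 / 250 / 2700 * (u / 100) by field.
by move=> h1 h2; split; lra.
Qed.

Lemma log_sq_le_far (x : nat) : (far_bound <= x)%N ->
  ln x%:R ^+ 2 <= 106 / 1000 / 1000 * x%:R :> R /\ 100 * 100 * ln x%:R <= 73 / 1000 * x%:R :> R.
Proof.
move=> Xx; have [_ [_ [b0 b1]]] := ln_numeric_bounds R.
have X2E : far_bound%:R = 200 * (100 * 100) :> R by rewrite !natrM.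
have X0 : (0 < far_bound)%N by [].
have X0R : 0 < far_bound%:R :> R by rewrite ltr0n.
have r1 : 1 <= x%:R / far_bound%:R :> R by rewrite ler_pdivlMr // mul1r ler_nat.
have x0 : (0 < x)%N by apply: leq_trans Xx.
have le : ln x%:R <= 1814 / 125 + ln (x%:R / far_bound%:R) :> R.
  rewrite ln_div_nat //; move: b1; move: (ln far_bound%:R) (ln x%:R) => a b; clear => h; lra.
have c2 : 2 <= 1814 / 125 :> R by clear; lra.
have [h1 h2] := ln_growth r1 c2 (@ln_nat_ge0 R x) le.
move: h1 h2; rewrite X2E; move: (ln x%:R : R) (x%:R : R) (ler0n R x) => l u u0; clear -u0.
have -> : (1814 / 125) ^+ 2 * (u / (200 * (100 * 100))) = (1814 / 125) ^+ 2 / 200 * (u / (100 * 100)) by field.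
have -> : 1814 / 125 * (u / (200 * (100 * 100))) = 1814 / 125 / 200 * (u / (100 * 100)) by field.
by move=> h1 h2; split; lra.
Qed.

End LargeArith.

Lemma far_bound_gt0 : (0 < far_bound)%N.
Proof. by rewrite /far_bound !muln_gt0. Qed.

Lemma sqr_519_le_near_bound : (519 ^ 2 <= near_bound)%N.
Proof. by rewrite /near_bound -mulnn; lia. Qed.

Lemma sqr_1414_le_far_bound : (1414 ^ 2 <= far_bound)%N.
Proof. by rewrite /far_bound -mulnn; lia. Qed.

Section LargeIntervals.
Variable R : realType.

Lemma large_count (N n k : nat) : (2 <= k)%N -> (0 < n)%N ->
  (near_bound <= k * n)%N -> (k * n < N)%N ->
  ln k%:R <= 10 / 11 * n%:R - (ln 5 - ln 2) :> R ->
  k%:R - 1 <= pcount R N (fun p => n <= p <= k * n)%N.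
Proof.
move=> k2 n0 Xx xN lk; set x := (k * n)%N in Xx xN *.
have k0 : (0 < k)%N by apply: leq_trans k2.
have X0 : (0 < near_bound)%N by [].
have x0 : (0 < x)%N by apply: leq_trans Xx.
have nx : (n <= x)%N by rewrite /x leq_pmull.
have nrx : (nrange <= x)%N by apply: leq_trans Xx; vm_compute.
have x0R : 0 < x%:R :> R by rewrite ltr0n.
have n0R : 0 < n%:R :> R by rewrite ltr0n.
have xE : x%:R = k%:R * n%:R :> R by rewrite natrM.
have [[_ _] [[bL _] [cL0 cL1]]] := ln_numeric_bounds R.
have LX : ln near_bound%:R <= ln x%:R :> R by apply: ln_nat_le.
have L1 : 125 / 10 <= ln x%:R :> R by apply: le_trans LX.
have L0 : 0 < ln x%:R :> R by apply: lt_le_trans L1; clear; lra.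
have L1' : 1 < ln x%:R :> R by apply: lt_le_trans L1; clear; lra.
have lx : ln x%:R = ln k%:R + ln n%:R :> R by rewrite /x lnM_nat.
have [Lsq Lx] := log_sq_le_near R Xx.
have x200 : (200 <= x <= x)%N by rewrite leqnn andbT; apply: leq_trans nrx.
have [nA|nB] := leP (15 / 10 * ln x%:R : R) n%:R.
  have nxN : (n <= x < N)%N by rewrite nx.
  have := interval_count_ge_psi R n0 nxN.
  set s := pcount R N _; set C := pcount R N _ => hC.
  have hp := psi_ge_near R Xx xN x200.
  apply: (count_ge_psi_arith _ n0R L0 xE nA (p := psi R N x) (s := s) (q := psi R N n)) => //.
  - by rewrite (ler_nat R 2 k).
  - by apply: le_trans hp; rewrite lerDl.
  - have [r rx xr] := sqrt_ex x.
    have sr := small_prime_count_le R N xr.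
    have r0 : 0 <= r%:R :> R by apply: ler0n.
    have rx2 : r%:R ^+ 2 <= x%:R :> R by rewrite -natrX ler_nat.
    (* [r <= sqrt x] and [ln x <= sqrt (0.00058 x)], where [sqrt 0.00058 < 0.0241]. *)
    have rl : r%:R * ln x%:R <= 241 / 100 / 100 * x%:R :> R.
      have q0 : 0 <= 241 / 100 / 100 * x%:R :> R by apply: mulr_ge0; [clear; lra | exact: ltW].
      have p0 : 0 <= r%:R * ln x%:R :> R by apply: mulr_ge0 => //; exact: ltW.
      rewrite -(@ler_pXn2r R 2) ?nnegrE // exprMn; apply: (@le_trans _ _ (x%:R * (58 / 1000 / 100 * x%:R))).
        by apply: ler_pM => //; rewrite exprn_ge0 // ltW.
      move: (x%:R : R) x0R => u u0; clear -u0; nra.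
    apply: (@le_trans _ _ ((r%:R + 5) / 3 * ln x%:R)); first by apply: ler_wpM2r; [exact: ltW | exact: sr].
    move: rl Lx; have -> : (r%:R + 5) / 3 * ln x%:R = (r%:R * ln x%:R + 5 * ln x%:R) / 3 :> R by field.
    by move: x0R; move: (x%:R : R) (ln x%:R) (r%:R * _) => a b c; clear => *; lra.
  - apply: le_trans (psi_le R n0 (leq_ltn_trans nx xN)) _; rewrite lerD2l.
    apply: (@le_trans _ _ (psi_err (ln x%:R))).
      by apply: le_psi_err; [exact: ln_nat_ge0 | exact: ln_nat_le].
    move: x0R Lsq Lx; rewrite /psi_err; move: (x%:R : R) (ln x%:R) (ln x%:R ^+ 2) => a b c.
    by clear => *; lra.
apply: le_trans (interval_count_ge_pcount R x (ltnW (leq_ltn_trans nx xN))).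
have kE : k%:R = x%:R / n%:R :> R by rewrite xE mulfK // lt0r_neq0.
(* Here [n] is so small that discarding all integers below [n] is affordable. *)
suff : x%:R / n%:R + n%:R <= pcount R N (fun p => p <= x)%N.
  by rewrite kE; move: (n%:R : R) (pcount R N _) (x%:R / n%:R) => a b c; clear => *; lra.
have m0 : 0 <= ln 100 :> R by apply: (@ln_nat_ge0 R 100).
have m1 : ln 100 <= 2303 / 500 :> R by apply: (@ln_tab_le R 2303 500 100 isT isT); vm_compute.
have [t1 t2] := tangent_consts R.
have nL : n%:R * ln x%:R <= 15 / 10 * ln x%:R ^+ 2 :> R.
  by rewrite expr2 mulrA; apply: ler_wpM2r; apply: ltW.
have [xX2|X2x] := ltnP x far_bound.
  have lX2 : ln x%:R <= 1814 / 125 :> R.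
    exact: le_trans (ln_nat_le R x0 (ltnW xX2)) cL1.
  (* 519 is the integer square root of 270000; 1414, used later, is that of 2000000. *)
  have K2 : (519 ^ 2 <= x)%N by apply: leq_trans Xx; exact: sqr_519_le_near_bound.
  have e0 : 0 <= 431 / 1000 / 100 :> R by clear; lra.
  have Pge := @pcount_ge R N x 519 (431 / 1000 / 100) nrx xN isT K2 e0 (fun y yr => psi_ge_near R Xx xN yr).
  apply: (count_ge_pi_arith (A0 := 967 / 1000) (A1 := 923 / 1000) (A2 := 8 / 10) (d := 13 / 100 / 100) x0R L1' n0R m0 m1 e0 _ _ _ _ _ _ Pge).
  - by rewrite (ltr0n R 519).
  - move: nL Lx L1 lX2; move: (x%:R : R) (ln x%:R) (n%:R * ln x%:R) => a c b.
    clear => h1 h2 h3 h4; have h5 : c ^+ 2 <= 1814 / 125 * c by nra.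
    lra.
  (* [151/154 = 10/11 + 1/14]: the hypothesis bounds [ln k], and the tangent at 14 bounds [ln n]. *)
  - apply: (ratio_le L0 (sigma := 151 / 154) (tau := 725 / 1000)) => //.
    + by apply: lt_le_trans L1; clear; lra.
    + by clear; lra.
    + have := @ln_tangent R n 14 n0 isT; rewrite lx.
      move: lk t1; move: (n%:R : R) (ln 5 - ln 2) (ln 14) (ln n%:R) (ln k%:R) => a b c d e.
      by clear => *; lra.
    + exact: cubic_near.
  - by clear; lra.
  - by clear; lra.
  - by clear; lra.
have [Lsq2 Lx2] := log_sq_le_far R X2x.
have L2 : 145 / 10 <= ln x%:R :> R.
  exact: (le_trans cL0 (ln_nat_le R far_bound_gt0 X2x)).
have K2 : (1414 ^ 2 <= x)%N by apply: leq_trans X2x; exact: sqr_1414_le_far_bound.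
have e0 : 0 <= 93 / 1000 / 100 :> R by clear; lra.
have Pge := @pcount_ge R N x 1414 (93 / 1000 / 100) nrx xN isT K2 e0 (fun y yr => psi_ge_far R X2x xN yr).
apply: (count_ge_pi_arith (A0 := 973 / 1000) (A1 := 939 / 1000) (A2 := 87 / 100) (d := 2 / 100 / 100) x0R L1' n0R m0 m1 e0 _ _ _ _ _ _ Pge).
- by rewrite (ltr0n R 1414).
- move: nL Lx2 Lsq2 L2; move: (x%:R : R) (ln x%:R) (ln x%:R ^+ 2) (n%:R * ln x%:R) => a c d b.
  by clear => h1 h2 h3 h4; lra.
(* [191/198 = 10/11 + 1/18]: now the tangent is taken at 18. *)
- apply: (ratio_le L0 (sigma := 191 / 198) (tau := 976 / 1000)) => //.
  + by apply: lt_le_trans L1; clear; lra.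
  + by clear; lra.
  + have := @ln_tangent R n 18 n0 isT; rewrite lx.
    move: lk t2; move: (n%:R : R) (ln 5 - ln 2) (ln 18) (ln n%:R) (ln k%:R) => a b c d e.
    by clear => *; lra.
  + exact: cubic_far.
- by clear; lra.
- by clear; lra.
- by clear; lra.
Qed.
End LargeIntervals.

(** * Small intervals *)

(** [c] counts down to the next entry to clear; the period is [r + 1]. *)
Fixpoint cross_out (c r : nat) (l : seq bool) : seq bool :=
  match l, c with
  | [::], _ => [::]
  | _ :: l', 0 => false :: cross_out r r l'
  | b :: l', c'.+1 => b :: cross_out c' r l'
  end.

(* Entry [i] of the list stands for the odd number [2 i + 3]; the odd multiples
   [3 p, 5 p, ...] of [p] are the entries [3 (p - 1) / 2 + j p]. *)
Definition sieve (ps : seq nat) (l : seq bool) : seq bool :=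
  foldr (fun p l => cross_out (3 * p.-1./2) p.-1 l) l ps.

Definition sieve_primes : seq nat := [seq p <- iota 3 518 | odd p && prime p].

Fixpoint survivors (m : N) (l : seq bool) : seq N :=
  match l with
  | [::] => [::]
  | b :: l' => if b then m :: survivors (2 + m) l' else survivors (2 + m) l'
  end.

(** The list ends at the odd number 271401, between 270000 and [521^2 = 271441], so primes below 521
    suffice for sieving. *)
Definition sieve_size : nat := 1357 * 100.

Definition odd_primes : seq N := survivors 3 (sieve sieve_primes (nseq sieve_size true)).

(* The [i]-th element of [t] has to be at most [acc + i n], as long as this is below [B]. *)
Fixpoint run_check (B n acc : N) (t : seq N) : bool :=
  if (B <=? acc)%num then true else
  match t with
  | [::] => false
  | q :: t' => if (q <=? acc)%num then run_check B n (n + acc) t' else false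
  end.

(** The primes after [p] are tested with the smallest [n] exceeding [p]; the start [2 n] reflects
    that the prime of index [i] is needed for [k = i + 2]. *)
Fixpoint walk_check (B : N) (l : seq N) : bool :=
  match l with
  | [::] => true
  | p :: t => if run_check B (1 + p) (2 * (1 + p)) t then walk_check B t else false
  end.

(* Pairs [(n, K)] with [k <= K] whenever [k <= 2/5 (72/29)^n] and [k n < 270000];
   for [n = 13] only the latter matters. *)
Definition small_cases : seq (N * N) :=
  [:: (2, 2); (3, 6); (4, 15); (5, 37); (6, 93); (7, 232); (8, 577); (9, 1433);
   (10, 3559); (11, 8837); (12, 21941); (13, 20770)]%num.

(** Each [n <= 13] is run separately up to its bound on [k]. For [n > 13] one walk from the prime 13
    serves all [n]. *)
Definition finite_check (L : seq N) : bool :=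
  let L13 := [seq p <- L | (13 <=? p)%num] in
  [&& all (fun c => run_check (1 + c.1 * c.2) c.1 (2 * c.1) [seq p <- L | (c.1 <=? p)%num]) small_cases,
      (head 0%num L13 =? 13)%num & walk_check (270 * 1000) L13].

Lemma finite_check_odd_primes : finite_check odd_primes.
Proof. by vm_cast_no_check (erefl true). Qed.

#[local] Arguments N.add : simpl never.
#[local] Arguments N.mul : simpl never.

Lemma nth_cross_out c r l i : nth false (cross_out c r l) i -> nth false l i.
Proof.
elim: l c i => [|b l IH] [|c] [|i] //=; exact: IH.
Qed.

Lemma nth_cross_out_false c r l j : nth false (cross_out c r l) (c + j * r.+1) = false.
Proof.
elim: l c j => [|b l IH] c j; first by rewrite /= nth_nil.
case: c => [|c] /=; last exact: IH.
by case: j => [|j] //=; rewrite mulSn add0n addSn /=; exact: IH.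
Qed.

Lemma nth_sieve ps l i : nth false (sieve ps l) i ->
  nth false l i /\ (forall p j, p \in ps -> (0 < p)%N -> i <> 3 * p.-1./2 + j * p)%N.
Proof.
elim: ps => [|p ps IH] //=; move=> h.
have [h1 h2] := IH (nth_cross_out h).
split=> // q j; rewrite inE => /orP[/eqP -> p0 iE|]; last exact: h2.
have := nth_cross_out_false (3 * p.-1./2) p.-1 (sieve ps l) j.
by rewrite (prednK p0) -iE h.
Qed.

(** A composite odd [m < 521^2] is [p q] with [p < 521] its least prime factor and [q >= 3] odd; its
    index is [3 (p - 1) / 2 + j p] with [j = (q - 3) / 2], so it was crossed out. *)
Lemma sieve_prime n i : (2 * i + 3 < 521 ^ 2)%N ->
  nth false (sieve sieve_primes (nseq n true)) i -> prime (2 * i + 3).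
Proof.
move=> iB /nth_sieve[_ h]; apply: contraT => np.
set m := (2 * i + 3)%N in iB np.
have m1 : (1 < m)%N by rewrite /m addn3.
have pp := pdiv_prime m1; have /dvdnP[q mE] := pdiv_dvd m.
have p2 : (pdiv m ^ 2 <= m)%N.
  by move: np; apply: contraR; rewrite -ltnNge; apply: ltn_pdiv2_prime; exact: ltnW.
set p := pdiv m in pp mE p2.
have p521 : (p < 521)%N by rewrite -(@ltn_sqr p 521); apply: leq_ltn_trans iB.
have mo : odd m by rewrite /m oddD oddM.
have [po qo] : odd p /\ odd q by apply/andP; rewrite andbC -oddM -mE.
have p3 : (2 < p)%N by rewrite odd_prime_gt2.
case: (h p (q - 3)./2).
- by rewrite mem_filter po pp mem_iota; move: p3 p521; clear; lia.
- by move: p3; clear; lia.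
have q3 : (3 <= q)%N.
  case: q mE qo {h} => [|[|[|q]]] //; rewrite mul1n => mE _.
  by move: p2 m1; rewrite -mE; clear; nia.
have [a pE] : exists a, p = (2 * a + 1)%N by exists p./2; move: po; clear; lia.
have [b qE] : exists b, q = (2 * b + 3)%N by exists (q - 3)./2; move: qo q3; clear; lia.
have -> : p.-1./2 = a by rewrite pE; lia.
have -> : (q - 3)./2 = b by rewrite qE; lia.
by move: mE; rewrite /m pE qE; clear; nia.
Qed.

Lemma mem_survivors m l p : p \in survivors m l ->
  exists2 i, nth false l i & p = (m + 2 * N.of_nat i)%num.
Proof.
elim: l m => [|b l IH] m //= h.
have [hb|] : (b /\ p = m) \/ p \in survivors (2 + m) l.
- by move: h; case: b; [rewrite inE => /orP[/eqP ->|]; [left|right]|right].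
- by case: hb => hb ->; exists 0%N => //; clear; lia.
by move=> /IH[i li ->]; exists i.+1 => //; clear; lia.
Qed.

Lemma survivors_sorted m l :
  pairwise N.ltb (survivors m l) /\ all (N.leb m) (survivors m l).
Proof.
elim: l m => [|b l IH] m //=.
have [h1 h2] := IH (2 + m)%num.
have a1 : all (N.leb m) (survivors (2 + m) l).
  by apply: sub_all h2 => x; lia.
case: b => //=; rewrite h1 a1; split; rewrite ?andbT //; last by lia.
by apply: sub_all h2 => x; lia.
Qed.

Lemma survivors_sieve_prime n p : (2 * n + 3 <= 521 ^ 2)%N ->
  p \in survivors 3 (sieve sieve_primes (nseq n true)) -> prime (N.to_nat p).
Proof.
move=> nB /mem_survivors[i hi ->].
have iS : (i < n)%N by have [h _] := nth_sieve hi; move: h; rewrite nth_nseq; case: ifP.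
have -> : N.to_nat (3 + 2 * N.of_nat i) = (2 * i + 3)%N by clear; lia.
apply: sieve_prime hi.
by apply: leq_trans nB; rewrite ltn_add2r ltn_mul2l.
Qed.

Lemma sieve_size_le : (2 * sieve_size + 3 <= 521 ^ 2)%N.
Proof. by rewrite /sieve_size -mulnn; lia. Qed.

Lemma odd_primes_prime p : p \in odd_primes -> prime (N.to_nat p).
Proof. exact: survivors_sieve_prime sieve_size_le. Qed.

Lemma odd_primes_sorted : pairwise N.ltb odd_primes.
Proof. exact: proj1 (survivors_sorted 3 _). Qed.

(** * From the list checks to a count of primes *)

Lemma run_checkP B n acc t : run_check B n acc t ->
  forall i, (acc + N.of_nat i * n < B)%num ->
  (i < size t)%N /\ (nth 0%num t i <= acc + N.of_nat i * n)%num.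
Proof.
elim: t acc => [|q t IH] acc /=; case: (N.leb_spec B acc) => hB // h i hi; try lia.
move: h; case: (N.leb_spec q acc) => // hq h.
case: i hi => [|i] hi; first by split=> //=; lia.
have [|h1 h2] := IH _ h i; first by lia.
by split => //=; lia.
Qed.

(** [p'] is the last listed element below [n], so the tail [t'] consists of elements at least
    [n]. *)
Lemma walk_checkP B n p t : pairwise N.ltb (p :: t) -> walk_check B (p :: t) -> (p < n)%num ->
  exists p' t', [/\ (p' < n)%num, run_check B (1 + p') (2 * (1 + p')) t',
                   all (N.leb n) t' & subseq t' t].
Proof.
elim: t p => [|q t IH] p.
  by rewrite /=; case: ifP => // h _ _ pn; exists p, [::].
rewrite (lock (q :: t)) /= -!lock => /andP[pa pt]; case: ifP => // h w pn.
have [qn|nq] := N.ltb_spec q n.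
  have [p' [t' [a b c d]]] := IH q pt w qn.
  by exists p', t'; split=> //; apply: subseq_trans d (subseq_cons _ _).
exists p, (q :: t); split=> //.
move: pt => /= /andP[qa _]; apply/andP; split; first by lia.
by apply: sub_all qa => x; lia.
Qed.

Definition primes_in (a b : nat) : seq nat := [seq p <- iota 0 b.+1 | prime p && (a <= p <= b)%N].

Lemma size_primes_in_ge n b m (t : seq N) :
  pairwise N.ltb t -> (forall p, p \in t -> prime (N.to_nat p)) ->
  all (N.leb (N.of_nat n)) t ->
  (forall i, (i < m)%N -> (i < size t)%N /\ (nth 0 t i <= N.of_nat b)%num) ->
  (m <= size (primes_in n b))%N.
Proof.
move=> ts tp tn tb.
have mt : (m <= size t)%N.
  by case: m tb => // m tb; have [] := tb m (leqnn _).
rewrite -(size_takel mt) -(size_map N.to_nat); apply: uniq_leq_size.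
  rewrite map_inj_uniq; last by move=> x y; lia.
  apply: take_uniq; move: ts; apply: pairwise_uniq => x; lia.
move=> _ /mapP[p pt ->].
have ptt := mem_take pt.
have pb : (p <= N.of_nat b)%num.
  move: pt => /(nthP 0%num)[i]; rewrite size_takel // => im <-.
  by rewrite nth_take //; have [] := tb i im.
have np := allP tn _ ptt.
rewrite mem_filter tp // mem_iota; move: pb np; clear; lia.
Qed.

(** The first [k - 1] elements have index [i <= k - 2], hence are at most [(i + 2) n0 <= k n]. *)
Lemma run_count B n0 n k (t : seq N) :
  pairwise N.ltb t -> (forall p, p \in t -> prime (N.to_nat p)) ->
  all (N.leb (N.of_nat n)) t -> (n0 <= N.of_nat n)%num ->
  (2 <= k)%N -> (N.of_nat k * N.of_nat n < B)%num -> run_check B n0 (2 * n0) t ->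
  (k.-1 <= size (primes_in n (k * n)))%N.
Proof.
move=> ts tp tn n0n k2 kB rt; apply: size_primes_in_ge ts tp tn _ => i ik.
have le : (2 * n0 + N.of_nat i * n0 <= N.of_nat k * N.of_nat n)%num.
  have -> : (2 * n0 + N.of_nat i * n0 = (2 + N.of_nat i) * n0)%num by clear; lia.
  by apply: N.mul_le_mono => //; move: ik k2; clear; lia.
have [|h1 h2] := run_checkP rt (i := i); first by move: le kB; clear; lia.
split=> //; move: h2 le; clear; lia.
Qed.

Lemma small_cases_cover :
  all (fun n => N.of_nat n \in [seq c.1 | c <- small_cases]) (iota 2 12) &&
  all (fun c => (2 * 72 ^ c.1 <? 5 * (1 + c.2) * 29 ^ c.1)%num
             || (270 * 1000 <=? (1 + c.2) * c.1)%num) small_cases.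
Proof. by vm_compute. Qed.

(** Stated for a variable list, so that no step of the proof can evaluate the sieve. *)
Lemma finite_count_from (L : seq N) (n k : nat) :
  pairwise N.ltb L -> (forall p, p \in L -> prime (N.to_nat p)) -> finite_check L ->
  (2 <= k)%N -> (2 <= n)%N -> (k * n < near_bound)%N ->
  (5 * N.of_nat k * 29 ^ N.of_nat n <= 2 * 72 ^ N.of_nat n)%num ->
  (k.-1 <= size (primes_in n (k * n)))%N.
Proof.
move=> Ls Lp /and3P[/allP hs /N.eqb_spec h13 hw] k2 n2 knX h.
have kn : (N.of_nat k * N.of_nat n < 270 * 1000)%num by move: knX; rewrite /near_bound; clear; lia.
have /andP[/allP cov /allP bnd] := small_cases_cover.
have {}Ls (a : pred N) : pairwise N.ltb [seq p <- L | a p] by apply: pairwise_filter.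
have {}Lp (a : pred N) p : p \in [seq p <- L | a p] -> prime (N.to_nat p).
  by rewrite mem_filter => /andP[_]; apply: Lp.
have [n14|n14] := leqP n 13.
  have /cov/mapP[[n' K] cin /= nE] : n \in iota 2 12 by rewrite mem_iota; move: n2 n14; clear; lia.
  have rt := hs _ cin; have bt := bnd _ cin; rewrite /= -nE in rt bt.
  have kK : (N.of_nat k <= K)%num.
    have [//|Kk] := N.leb_spec (N.of_nat k) K; exfalso.
    case/orP: bt => [/N.ltb_spec0 | /N.leb_spec0] bt.
      have : (5 * (1 + K) * 29 ^ N.of_nat n <= 5 * N.of_nat k * 29 ^ N.of_nat n)%num.
        by apply: N.mul_le_mono_r; apply: N.mul_le_mono_l; move: Kk; clear; lia.
      by move: bt h; clear; lia.
    have : ((1 + K) * N.of_nat n <= N.of_nat k * N.of_nat n)%num.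
      by apply: N.mul_le_mono_r; move: Kk; clear; lia.
    by move: bt kn; clear; lia.
  apply: (run_count (Ls _) (Lp _) _ (N.le_refl _) k2 _ rt).
    by apply/allP => x; rewrite mem_filter => /andP[].
  have : (N.of_nat k * N.of_nat n <= K * N.of_nat n)%num by apply: N.mul_le_mono_r.
  by clear; lia.
case: [seq p <- L | _] h13 hw (Ls (N.leb 13)) (Lp (N.leb 13)) => [|p t] //= -> hw ts tp.
have p13 : (13 < N.of_nat n)%num by move: n14; clear; lia.
have [p' [t' [pn rt tn st]]] := walk_checkP ts hw p13.
apply: (run_count (n0 := (1 + p')%num) _ _ tn _ k2 kn rt).
- by apply: subseq_pairwise st _; case/andP: ts.
- by move=> q /(mem_subseq st) qt; apply: tp; rewrite inE qt orbT.
- by move: pn; clear; lia.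
Qed.

Lemma of_nat_expn a n : N.of_nat (a ^ n) = (N.of_nat a ^ N.of_nat n)%num.
Proof.
elim: n => [|n IH]; first by rewrite N.pow_0_r.
by rewrite expnS Nnat.Nat2N.inj_mul IH Nnat.Nat2N.inj_succ N.pow_succ_r'.
Qed.

Lemma finite_count (n k : nat) : (2 <= k)%N -> (0 < n)%N -> (k * n < near_bound)%N ->
  (5 * k * 29 ^ n <= 2 * 72 ^ n)%N ->
  (k.-1 <= size (primes_in n (k * n)))%N.
Proof.
move=> k2 n0 knX h.
have n2 : (2 <= n)%N.
  (* For [n = 1] the hypothesis would give [145 k <= 144]. *)
  by case: n n0 h {knX} => [|[|n]] // _; rewrite !expn1; move: k2; clear; lia.
apply: finite_count_from odd_primes_sorted odd_primes_prime finite_check_odd_primes k2 n2 knX _.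
have := of_nat_expn 29 n; have := of_nat_expn 72 n; move: h.
move: (29 ^ n)%N (72 ^ n)%N (_ ^ _)%num (_ ^ _)%num => a b c d; clear; lia.
Qed.

(** * From the logarithmic hypothesis to the theorem *)

Section Final.
Variable R : realType.

(** Exponentiation, with [72/29] a rational number just above [exp (10/11)], makes the hypothesis a
    statement on integers. *)
Lemma pow_le_of_ln_le (n k : nat) : (0 < k)%N ->
  ln k%:R <= 10 / 11 * n%:R - (ln 5 - ln 2) :> R -> (5 * k * 29 ^ n <= 2 * 72 ^ n)%N.
Proof.
move=> k0 h.
have l1 : 21383 / 5000 <= ln 72 :> R by apply: (@ln_tab_ge R 21383 5000 72 isT isT); vm_compute.
have l2 : ln 29 <= 16837 / 5000 :> R by apply: (@ln_tab_le R 16837 5000 29 isT isT); vm_compute.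
have p1 m : (0 < m)%N -> (0 < m ^ n)%N by move=> m0; rewrite expn_gt0 m0.
have l3 : 10 / 11 * n%:R <= (ln 72 - ln 29) * n%:R :> R.
  apply: ler_wpM2r; first exact: ler0n.
  by move: l1 l2; move: (ln 72) (ln 29) => a b; clear => *; lra.
rewrite -(ler_nat R) -ler_ln ?posrE ?ltr0n ?muln_gt0 ?k0 ?p1 //.
rewrite !lnM_nat ?muln_gt0 ?k0 ?p1 // !lnXn_nat //.
move: h l3; move: (n%:R : R) (ln k%:R) (ln 72) (ln 29) (ln 5) (ln 2) => a b c d e g.
by clear => *; lra.
Qed.

Lemma pcount_primes_in (n b : nat) :
  pcount R b.+1 (fun p => n <= p <= b)%N = (size (primes_in n b))%:R.
Proof.
rewrite /pcount /primes_in size_filter -sum1_count natr_sum /index_iota subn0.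
rewrite big_mkcond [RHS]big_mkcond; apply: eq_bigr => p _ /=.
by case: prime => //=; case: andP.
Qed.

Lemma primes_in_ge (n k : nat) : (0 < n)%N -> (2 <= k)%N ->
  ln k%:R <= 10 / 11 * n%:R - (ln 5 - ln 2) :> R ->
  (k.-1 <= size (primes_in n (k * n)))%N.
Proof.
move=> n0 k2 lk; have [knX|Xkn] := ltnP (k * n) near_bound.
  by apply: finite_count => //; apply: pow_le_of_ln_le lk; apply: ltnW.
have := large_count k2 n0 Xkn (leqnn _) lk.
rewrite pcount_primes_in -(ler_nat R) -subn1 natrB //; exact: ltnW.
Qed.
End Final.

Lemma size_primes_between (n b : nat) : size (primes_between n b) = size (primes_in n b).
Proof. by []. Qed.

Theorem theorem3p6 (R : realType) (n k : int) (hk : 1 <= k) (hn : f R k <= n) :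
  k - 1 <= (size (primes_between n (k * n)))%:Z.
Proof.
have [k1|k2] := leP k 1.
  have -> : k = 1 by apply/le_anti; rewrite k1.
  by rewrite subrr.
case: k hk hn k2 => // k _ hn k2.
have k2' : (2 <= k)%N by [].
have k0 : (0 < k)%N by apply: ltnW.
have hn' : 11 / 10 * ln (5 / 2 * k%:R) <= n%:~R :> R.
  by move: hn; rewrite /f -(ler_int R) => /(le_trans (Num.Theory.ceil_ge _)).
have kR : 0 < k%:R :> R by rewrite ltr0n.
have lE : ln (5 / 2 * k%:R) = ln 5 - ln 2 + ln k%:R :> R.
  by rewrite !lnM ?lnV ?posrE ?invr_gt0 ?divr_gt0.
have l0 : 0 < ln (5 / 2 * k%:R) :> R.
  apply: ln_gt0; have : 2 <= k%:R :> R by rewrite (ler_nat R 2).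
  by move: (k%:R : R) => a; clear; lra.
(* [5/2 k > 1] makes the logarithm positive, so the hypothesis forces [n] to be positive. *)
have n0 : 0 < n.
  by rewrite -(ltr0z R); apply: lt_le_trans hn'; apply: mulr_gt0 => //; clear; lra.
case: n n0 hn' {hn} => // n n0 hn'.
rewrite -PoszM size_primes_between.
have -> : Posz k - 1 = Posz k.-1 by rewrite -{1}(prednK k0) -addn1 PoszD addrK.
rewrite lez_nat; apply: (@primes_in_ge R) => //.
move: hn'; rewrite lE -pmulrn; move: (n%:R : R) (ln k%:R) (ln 5) (ln 2) => a b c d.
by clear => *; lra.
Qed.
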